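(* Let $(M,\tau)$ be a tracial $W^*$-probability space, $B\subset M$ a unital $*$-subalgebra and $E:M\to B$ a conditional expectation with $\tau\circ E=\tau$. Let $A_1,A_2$ be two subalgebras with $B\subset A_1,A_2\subset M$ which are algebraically free modulo $B$, and let $A=A_1\vee A_2$. Let $j\in L^2(A_1,A_2)$. Then the defining equations of the $B$-valued liberation gradient $j=j_B(A_1:A_2)$, $$E(ja)=(E\otimes E)(\delta_{A_1:A_2}(a))\qquad\text{for all }a\in A,$$ are equivalent to the following system of equations in terms of $B$-valued cumulants: $\kappa^B(j)=0$ and, for all $m\ge1$ and all $a_1,\dots,a_m\in A_1\cup A_2$, $$\kappa^B(j,a_1,\dots,a_m)=\begin{cases}0,&\text{if }a_1,a_m\in A_1\text{ or if }a_1,a_m\in A_2,\\-\kappa^B(a_1,\dots,a_m),&\text{if }a_1\in A_1\text{ and }a_m\in A_2,\\+\kappa^B(a_1,\dots,a_m),&\text{if }a_1\in A_2\text{ and }a_m\in A_1.\end{cases}$$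
   Context: A tracial $W^*$-probability space $(M,\tau)$ is a von Neumann algebra $M$ with a faithful normal trace (tracial state) $\tau$. $L^2(S_1,\dots,S_p)$ is the closure, in $\|a\|_{L^2}^2=\tau(aa^* )$, of the von Neumann algebra generated by the $S_i$. A conditional expectation is a unital $B$-bimodule linear map; being $\tau$-preserving, $E$ extends to $L^2(M,\tau)$. $A_1\vee A_2$ is the algebra generated by $A_1$ and $A_2$; algebraically free modulo $B$ means that the canonical homomorphism $A_1*_BA_2\to A_1\vee A_2$ has trivial kernel. $\delta_{A_1:A_2}:A\to A\otimes_BA$ is the derivation determined by $\delta_{A_1:A_2}(a)=a\otimes1-1\otimes a$ for $a\in A_1$ and $\delta_{A_1:A_2}(a)=0$ for $a\in A_2$; and $(E\otimes E)(a\otimes\hat a)=E(a)E(\hat a)$. $B$-valued cumulants: $\kappa^B$ is the family of $\mathbb C$-multilinear, $B$-balanced maps ($\kappa^B(bm_1,\dots)=b\kappa^B(m_1,\dots)$, $\kappa^B(\dots,m_nb)=\kappa^B(\dots,m_n)b$, $\kappa^B(\dots,m_jb,m_{j+1},\dots)=\kappa^B(\dots,m_j,bm_{j+1},\dots)$) determined recursively by $E(m_1\cdots m_n)=\sum_{\pi\in NC(n)}\kappa^B_\pi(m_1,\dots,m_n)$, where $NC(n)$ denotes non-crossing partitions, $\kappa^B_{1_n}=\kappa^B$ for the one-block partition, and, if $\{p+1,\dots,p+q\}$ is an interval block of $\pi$ (not the only block) and $\pi'$ is $\pi$ with this block removed, $\kappa^B_\pi(m_1,\dots,m_n)=\kappa^B_{\pi'}(m_1,\dots,m_p\kappa^B(m_{p+1},\dots,m_{p+q}),m_{p+q+1},\dots,m_n)$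 (for $p=0$ the value multiplies $m_{q+1}$ from the left). The same formulas define $\kappa^B(\xi,m_2,\dots,m_n)$ for a first argument $\xi\in L^2(M,\tau)$, using the extension of $E$. *)

(* Defs.v *)
From HB Require Import structures.
From mathcomp Require Import all_boot all_order all_algebra.
From mathcomp Require Import sesquilinear complex.
From mathcomp Require Import all_classical all_reals all_analysis.
Set Implicit Arguments.
Unset Strict Implicit.
Unset Printing Implicit Defensive.
Import Order.TTheory GRing.Theory Num.Theory numFieldNormedType.Exports.
Local Open Scope classical_set_scope.
Local Open Scope complex_scope.
Local Open Scope ring_scope.

(** * Von Neumann algebras *)

Section Commutant.
Variables (K : numFieldType) (H : normedModType K).

Definition bounded_op (T : H -> H) : Prop := linear T /\ continuous T.

Definition commutant (S : set (H -> H)) : set (H -> H) :=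
  [set T | bounded_op T /\ forall X, S X -> T \o X = X \o T].

End Commutant.

(* A unital algebra together with a faithful unital *-representation on a
   Hilbert space whose image equals its bicommutant. That star is an
   involutive conjugate-linear anti-automorphism is forced by vN_adjoint and
   the injectivity of vN_rep. *)
Record vNalgebra (R : realType) := VNAlgebra {
  vN_sort :> algType R[i];
  vN_star : vN_sort -> vN_sort;
  vN_space : completeNormedModType R[i];
  vN_dot : {dot vN_space for Num.conj};
  vN_norm : forall v, `|v| ^+ 2 = vN_dot v v;
  vN_rep : vN_sort -> vN_space -> vN_space;
  vN_rep_bounded : forall x, bounded_op (vN_rep x);
  vN_rep_linear : forall c x y v,
    vN_rep (c *: x + y) v = c *: vN_rep x v + vN_rep y v;
  vN_rep1 : forall v, vN_rep 1 v = v;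
  vN_repM : forall x y v, vN_rep (x * y) v = vN_rep x (vN_rep y v);
  vN_rep_inj : injective vN_rep;
  vN_adjoint : forall x v w,
    vN_dot (vN_rep x v) w = vN_dot v (vN_rep (vN_star x) w);
  vN_bicommutant : commutant (commutant (range vN_rep)) = range vN_rep
}.

Section Algebras.
Variables (R : realType) (M : vNalgebra R).
Implicit Types (S N : set M) (x y : M).

Definition vN_ge0 x : Prop :=
  forall v : vN_space M, 0 <= vN_dot M (vN_rep x v) v.

Definition vN_le x y : Prop := vN_ge0 (y - x).

Definition self_adjoint x : Prop := vN_star x = x.

Definition is_lub_sa (D : set M) (s : M) : Prop :=
  [/\ self_adjoint s,
      forall x, D x -> vN_le x s &
      forall y, self_adjoint y -> (forall x, D x -> vN_le x y) -> vN_le s y].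

Record faithful_normal_trace (tau : {scalar M}) : Prop := {
  trace_ge0 : forall x, 0 <= tau (vN_star x * x);
  trace1 : tau 1 = 1;
  traceC : forall x y, tau (x * y) = tau (y * x);
  trace_faithful : forall x, tau (vN_star x * x) = 0 -> x = 0;
  (* tau preserves suprema of upward directed sets; tau s is an upper bound
     of the image by positivity *)
  trace_normal : forall (D : set M) (s : M),
    D !=set0 -> D `<=` self_adjoint ->
    (forall x y, D x -> D y -> exists z, [/\ D z, vN_le x z & vN_le y z]) ->
    is_lub_sa D s ->
    forall c, (forall x, D x -> tau x <= c) -> tau s <= c
}.

Definition subalgebra S : Prop :=
  [/\ S 1,
      forall (c : R[i]) x y, S x -> S y -> S (c *: x + y) &
      forall x y, S x -> S y -> S (x * y)].

Definition star_subalgebra S : Prop :=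
  subalgebra S /\ forall x, S x -> S (vN_star x).

Definition vN_subalgebra N : Prop :=
  star_subalgebra N /\
  commutant (commutant (@vN_rep R M @` N)) = @vN_rep R M @` N.

Definition algebra_generated S : set M :=
  [set x | forall N, subalgebra N -> S `<=` N -> N x].

Definition vN_generated S : set M :=
  [set x | forall N, vN_subalgebra N -> S `<=` N -> N x].

Definition alg_join (A1 A2 : set M) : set M := algebra_generated (A1 `|` A2).

(* B-bimodule linear, with values in B *)
Record conditional_expectation (B : set M) (E : {linear M -> M}) : Prop := {
  cexp_in : forall x, B (E x);
  cexp1 : E 1 = 1;
  cexp_bimod : forall b x b', B b -> B b' -> E (b * x * b') = b * E x * b'
}.

(** * Amalgamated free products of algebras *)

(* f : S -> P; only the values of f on S matter *)
Definition alg_hom_on (P : algType R[i]) S (f : M -> P) : Prop :=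
  [/\ f 1 = 1,
      forall c x y, S x -> S y -> f (c *: x + y) = c *: f x + f y &
      forall x y, S x -> S y -> f (x * y) = f x * f y].

Definition is_amalgamated_free_product (B A1 A2 : set M) (P : algType R[i])
    (i1 i2 : M -> P) : Prop :=
  [/\ alg_hom_on A1 i1, alg_hom_on A2 i2, {in B, i1 =1 i2} &
      forall (Q : algType R[i]) (f1 f2 : M -> Q),
        alg_hom_on A1 f1 -> alg_hom_on A2 f2 -> {in B, f1 =1 f2} ->
        exists! g : P -> Q, exists g' : {lrmorphism P -> Q},
          [/\ g = g', {in A1, g \o i1 =1 f1} & {in A2, g \o i2 =1 f2}]].

Definition algebraically_free_modulo (B A1 A2 : set M) : Prop :=
  exists (P : algType R[i]) (i1 i2 : M -> P),
    is_amalgamated_free_product B A1 A2 i1 i2 /\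
    forall phi : {lrmorphism P -> M},
      {in A1, forall x, phi (i1 x) = x} -> {in A2, forall x, phi (i2 x) = x} ->
      forall p, phi p = 0 -> p = 0.

(** * The tensor product of A with itself over B *)

(* f : A x A -> W; only the values of f on A x A matter *)
Definition balanced_bilinear_on (B A : set M) (W : lmodType R[i])
    (f : M -> M -> W) : Prop :=
  [/\ forall c x x' y, A x -> A x' -> A y ->
        f (c *: x + x') y = c *: f x y + f x' y,
      forall c x y y', A x -> A y -> A y' ->
        f x (c *: y + y') = c *: f x y + f x y' &
      forall x b y, A x -> B b -> A y -> f (x * b) y = f x (b * y)].

(* The space, characterised by its universal property, with its A-bimodule
   structure *)
Record balanced_tensor (B A : set M) := BalancedTensor {
  tens_sort :> lmodType R[i];
  tens : M -> M -> tens_sort;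
  tens_balanced : balanced_bilinear_on B A tens;
  tens_universal : forall (W : lmodType R[i]) (f : M -> M -> W),
    balanced_bilinear_on B A f ->
    exists! g : tens_sort -> W, exists g' : {linear tens_sort -> W},
      g = g' /\ forall x y, A x -> A y -> g (tens x y) = f x y;
  tens_lact : M -> {linear tens_sort -> tens_sort};
  tens_lactE : forall a x y, A a -> A x -> A y ->
    tens_lact a (tens x y) = tens (a * x) y;
  tens_ract : M -> {linear tens_sort -> tens_sort};
  tens_ractE : forall a x y, A a -> A x -> A y ->
    tens_ract a (tens x y) = tens x (y * a)
}.

Record liberation_derivation (B A1 A2 : set M)
    (T : balanced_tensor B (alg_join A1 A2)) (delta : M -> T) : Prop := {
  delta_linear : forall c x y, alg_join A1 A2 x -> alg_join A1 A2 y ->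
    delta (c *: x + y) = c *: delta x + delta y;
  deltaM : forall x y, alg_join A1 A2 x -> alg_join A1 A2 y ->
    delta (x * y) = tens_ract T y (delta x) + tens_lact T x (delta y);
  delta1 : forall a, A1 a -> delta a = tens T a 1 - tens T 1 a;
  delta2 : forall a, A2 a -> delta a = 0
}.

Definition is_tensor_square (B A : set M) (T : balanced_tensor B A)
    (E : M -> M) (EE : {linear T -> M}) : Prop :=
  forall x y, A x -> A y -> EE (tens T x y) = E x * E y.

End Algebras.

(** * The completion in the trace norm *)

(* L^2(M, tau) with its M-bimodule structure, the continuous extension of
   left and right multiplication *)
Record L2_space (R : realType) (M : vNalgebra R) (tau : {scalar M}) := L2Space {
  L2_sort :> completeNormedModType R[i];
  L2_inj : {linear M -> L2_sort};
  L2_normE : forall x, `|L2_inj x| ^+ 2 = tau (x * vN_star x);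
  L2_dense : dense (range L2_inj);
  L2_lact : M -> {linear L2_sort -> L2_sort};
  L2_lact_continuous : forall a, continuous (L2_lact a);
  L2_lactE : forall a x, L2_lact a (L2_inj x) = L2_inj (a * x);
  L2_ract : M -> {linear L2_sort -> L2_sort};
  L2_ract_continuous : forall a, continuous (L2_ract a);
  L2_ractE : forall a x, L2_ract a (L2_inj x) = L2_inj (x * a)
}.

Section L2.
Variables (R : realType) (M : vNalgebra R) (tau : {scalar M}).
Variable L2 : L2_space tau.

Definition is_L2_extension (f : M -> M) (F : L2 -> L2) : Prop :=
  continuous F /\ forall x, F (L2_inj L2 x) = L2_inj L2 (f x).

Definition L2_generated (S : set M) : set L2 :=
  closure (L2_inj L2 @` vN_generated S).

End L2.

(** * Non-crossing partitions *)

Definition noncrossing n (pi : {set {set 'I_n}}) : bool :=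
  [forall V in pi, forall W in pi,
    [exists i in V, exists j in W, exists k in V, exists l in W,
       (i < j)%N && (j < k)%N && (k < l)%N] ==> (V == W)].

Definition NC n : {set {set {set 'I_n}}} :=
  [set pi : {set {set 'I_n}} | finset.partition pi [set: 'I_n]%SET && noncrossing pi]%SET.

(* The 0-based positions p, .., p + q - 1 *)
Definition interval_block p q r : {set 'I_(p + q + r)} :=
  [set i : 'I_(p + q + r) | (p <= i < p + q)%N]%SET.

(* The image of V under the increasing bijection from the positions < p + r
   to the positions < p + q + r outside interval_block p q r *)
Definition insert_gap p q r (V : {set 'I_(p + r)}) : {set 'I_(p + q + r)} :=
  [set i : 'I_(p + q + r) |
    [exists k in V, val i == (if (k < p)%N then k : nat else q + k)%N]]%SET.

Definition remove_block p q r (pi : {set {set 'I_(p + q + r)}}) :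
    {set {set 'I_(p + r)}} :=
  [set V : {set 'I_(p + r)} | insert_gap q V \in pi]%SET.

(** * Operator-valued cumulants *)

Section Cumulants.
Variables (R : realType) (M : vNalgebra R) (B : set M) (E : M -> M).

(* kappa [:: m_1; ..; m_n] is the n-th cumulant and kappa_part pi the
   multiplicative extension to pi, applied to lists of length n; values on the
   empty list, at other lengths and at crossing pi are irrelevant. *)
Record cumulants (kappa : seq M -> M)
    (kappa_part : forall n, {set {set 'I_n}} -> seq M -> M) : Prop := {
  kappa_in : forall s, s <> [::] -> B (kappa s);
  kappa_linear : forall u c x y w,
    kappa (u ++ (c *: x + y) :: w) =
    c *: kappa (u ++ x :: w) + kappa (u ++ y :: w);
  kappa_left : forall b x w, B b -> kappa (b * x :: w) = b * kappa (x :: w);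
  kappa_right : forall b u x, B b ->
    kappa (rcons u (x * b)) = kappa (rcons u x) * b;
  kappa_balanced : forall b u x y w, B b ->
    kappa (u ++ x * b :: y :: w) = kappa (u ++ x :: b * y :: w);
  moment_cumulant : forall s, s <> [::] ->
    E (\prod_(x <- s) x) = \sum_(pi in NC (size s)) kappa_part (size s) pi s;
  kappa_one_block : forall s, s <> [::] ->
    kappa_part (size s) [set [set: 'I_(size s)]]%SET s = kappa s;
  kappa_inner_block : forall u x v w
      (pi : {set {set 'I_((size u).+1 + size v + size w)}}),
    pi \in NC _ -> v <> [::] -> interval_block _ _ _ \in pi ->
    kappa_part _ pi (rcons u x ++ v ++ w) =
    kappa_part _ (remove_block pi) (rcons u (x * kappa v) ++ w);
  kappa_first_block : forall v y w
      (pi : {set {set 'I_(0 + size v + (size w).+1)}}),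
    pi \in NC _ -> v <> [::] -> interval_block _ _ _ \in pi ->
    kappa_part _ pi (v ++ y :: w) =
    kappa_part _ (remove_block pi) (kappa v * y :: w)
}.

Variables (tau : {scalar M}) (L2 : L2_space tau) (E2 : L2 -> L2).
Variable kappa : seq M -> M.

(* kappa2 xi [:: m_2; ..; m_n] is the n-th cumulant of (xi, m_2, .., m_n) with
   xi in L^2; position 0 of a partition corresponds to xi, and the cumulants
   kappa are those of elements of M. *)
Record L2_cumulants (kappa2 : L2 -> seq M -> L2)
    (kappa2_part : forall n, {set {set 'I_n}} -> L2 -> seq M -> L2) : Prop := {
  kappa2_linear1 : forall c xi eta s,
    kappa2 (c *: xi + eta) s = c *: kappa2 xi s + kappa2 eta s;
  kappa2_linear : forall xi u c x y w,
    kappa2 xi (u ++ (c *: x + y) :: w) =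
    c *: kappa2 xi (u ++ x :: w) + kappa2 xi (u ++ y :: w);
  kappa2_left : forall b xi s, B b ->
    kappa2 (L2_lact L2 b xi) s = L2_lact L2 b (kappa2 xi s);
  kappa2_right1 : forall b xi, B b ->
    kappa2 (L2_ract L2 b xi) [::] = L2_ract L2 b (kappa2 xi [::]);
  kappa2_right : forall b xi u x, B b ->
    kappa2 xi (rcons u (x * b)) = L2_ract L2 b (kappa2 xi (rcons u x));
  kappa2_balanced1 : forall b xi y w, B b ->
    kappa2 (L2_ract L2 b xi) (y :: w) = kappa2 xi (b * y :: w);
  kappa2_balanced : forall b xi u x y w, B b ->
    kappa2 xi (u ++ x * b :: y :: w) = kappa2 xi (u ++ x :: b * y :: w);
  moment_cumulant2 : forall xi s,
    E2 (L2_ract L2 (\prod_(x <- s) x) xi) =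
    \sum_(pi in NC (size s).+1) kappa2_part (size s).+1 pi xi s;
  kappa2_one_block : forall xi s,
    kappa2_part (size s).+1 [set [set: 'I_(size s).+1]]%SET xi s = kappa2 xi s;
  kappa2_inner_block : forall xi u x v w
      (pi : {set {set 'I_((size u).+2 + size v + size w)}}),
    pi \in NC _ -> v <> [::] -> interval_block _ _ _ \in pi ->
    kappa2_part _ pi xi (rcons u x ++ v ++ w) =
    kappa2_part _ (remove_block pi) xi (rcons u (x * kappa v) ++ w);
  kappa2_second_block : forall xi v w
      (pi : {set {set 'I_(1 + size v + size w)}}),
    pi \in NC _ -> v <> [::] -> interval_block _ _ _ \in pi ->
    kappa2_part _ pi xi (v ++ w) =
    kappa2_part _ (remove_block pi) (L2_ract L2 (kappa v) xi) w;
  kappa2_first_block : forall xi v y w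
      (pi : {set {set 'I_(0 + (size v).+1 + (size w).+1)}}),
    pi \in NC _ -> interval_block _ _ _ \in pi ->
    kappa2_part _ pi xi (v ++ y :: w) =
    kappa2_part _ (remove_block pi) (L2_ract L2 y (kappa2 xi v)) w
}.

(* The right-hand side of the cumulant system. The cases are tried in order,
   which matters for a list of length 1 whose entry lies in both A1 and A2.
   The final default 0 is never reached when both ends lie in A1 or A2. *)
Definition liberation_cumulant (A1 A2 : set M) (a : M) (s : seq M) : M :=
  let z := last a s in
  if `[< (A1 a /\ A1 z) \/ (A2 a /\ A2 z) >] then 0
  else if `[< A1 a /\ A2 z >] then - kappa (a :: s)
  else if `[< A2 a /\ A1 z >] then kappa (a :: s)
  else 0.

End Cumulants.

(* Main.v *)
Require Import Defs.
From HB Require Import structures.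
From mathcomp Require Import all_boot all_order all_algebra.
From mathcomp Require Import sesquilinear complex.
From mathcomp Require Import all_classical all_reals all_analysis.
From mathcomp Require Import zify.
Set Implicit Arguments.
Unset Strict Implicit.
Unset Printing Implicit Defensive.
Import Order.TTheory GRing.Theory Num.Theory numFieldNormedType.Exports.
Local Open Scope classical_set_scope.
Local Open Scope complex_scope.
Local Open Scope ring_scope.

(* The moment-cumulant formula is first regrouped by the block V of the first
   argument: between two consecutive elements of V, and after the last one, the
   sum over non-crossing partitions collapses to an expectation, so that
   E(x a_1 .. a_m) is the sum over subwords a_i1 .. a_ik of
   kappa(x, E(gap) a_i1, .., E(gap) a_ik) E(gap). This holds for x in M and for
   x in L^2.

   On words in A1 and A2 the right-hand side of the cumulant system is
   ([last letter in A1] - [first letter in A1]) kappa. Inserted in the formula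
   for E(j a_1 .. a_m), the first term, grouped by the position p of the last
   letter of the subword, gives E(a_1 .. a_p) E(a_(p+1) .. a_m) for each a_p in
   A1, and the second, grouped by the position p of the first letter, gives
   E(a_1 .. a_(p-1)) E(a_p .. a_m). Their difference is (E (x) E)(delta(a_1 .. a_m)),
   so the cumulant system implies the gradient equations. For the converse,
   both sides are determined recursively by the same triangular system.

   The moment formula grouped by the block of the last argument follows
   algebraically from the one for the first argument, by counting the sum over
   all nonempty subwords in both ways. *)

(** * Partitions as labellings *)

Section LabelledPartitions.
Local Open Scope nat_scope.
Local Open Scope set_scope.
Implicit Types (l t : seq nat) (a b x y z : nat).

(** A partition of positions is encoded by a word of block labels, and a crossing is a pattern
    [a b a b] with [a] different from [b]. Removing and inserting blocks then become list operations
    instead of maps between ordinal types. *)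
Definition nc l : Prop := forall a b, subseq [:: a; b; a; b] l -> a = b.

Lemma nc_subseq l l' : subseq l l' -> nc l' -> nc l.
Proof. by move=> sub nc_l' a b /subseq_trans/(_ sub)/nc_l'. Qed.

(** Peels off the first letter of a subsequence together with its position. Iterated, it turns a
    pattern [a b a b] into four increasing positions and back. *)
Lemma subseq_dropP a t k l : reflect
  (exists i, [/\ k <= i, i < size l, nth 0 l i = a & subseq t (drop i.+1 l)])
  (subseq (a :: t) (drop k l)).
Proof.
apply: (iffP idP) => [|[i [le_ki lt_i <- sub]]]; last first.
  apply: (@subseq_trans _ (drop i l)); first by rewrite (drop_nth 0 lt_i) /= eqxx.
  by rewrite -(subnK le_ki) -drop_drop drop_subseq.
elim: l k => [|y l IH] [|k] //=; last first.
  by move=> /IH[i [le_ki lt_i ai sub]]; exists i.+1.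
case: eqP => [<- sub|_]; first by exists 0; rewrite /= drop0.
by rewrite -{1}(drop0 l) => /IH[i [_ lt_i ai sub]]; exists i.+1.
Qed.

Lemma subseq_catIr l1 l a t : a \notin l1 ->
  subseq (a :: t) (l1 ++ l) = subseq (a :: t) l.
Proof.
elim: l1 => //= y l1 IH; rewrite inE negb_or => /andP[/negPf ->].
exact: IH.
Qed.

Lemma subseq_catIl l l3 a t : a \notin l3 ->
  subseq (rcons t a) (l ++ l3) = subseq (rcons t a) l.
Proof.
move=> al3; rewrite -subseq_rev rev_cat rev_rcons subseq_catIr ?mem_rev //.
by rewrite -rev_rcons subseq_rev.
Qed.

Lemma nc_map (f : nat -> nat) l : {in l &, injective f} ->
  nc (map f l) <-> nc l.
Proof.
move=> f_inj; split=> nc_l a b sub.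
  have sub' := map_subseq f sub.
  by apply: f_inj (nc_l _ _ sub'); apply: (mem_subseq sub); rewrite !inE eqxx ?orbT.
have [m sz_m e] := subseqP sub.
move: e; rewrite -map_mask.
have := @mask_subseq _ m l; case: (mask m l) => [|a1 [|b1 [|a2 [|b2 []]]]] //= sub1.
have in1 : {subset [:: a1; b1; a2; b2] <= l} by apply: mem_subseq.
case=> ea1 eb1 ea2 eb2.
have aa : a1 = a2 by apply: f_inj; rewrite ?in1 ?inE ?eqxx ?orbT // -ea1.
have bb : b1 = b2 by apply: f_inj; rewrite ?in1 ?inE ?eqxx ?orbT // -eb1.
by rewrite ea1 eb1; congr f; apply: nc_l; rewrite {2}aa {2}bb.
Qed.

(* The block with the largest minimum is an interval, and it is not the
   initial one unless it is the only block. *)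
Lemma nc_last_block l : nc l -> l != [::] ->
  exists m1 k x m3, [/\ l = m1 ++ nseq k.+1 x ++ m3, x \notin m1,
    x \notin m3 & {subset m3 <= m1}].
Proof.
elim/last_ind: l => // l y IH nc_l _.
have [->|l_n0] := eqVneq l [::]; first by exists [::], 0, y, [::].
have [|m1 [k [x [m3 [def_l x1 x3 sub31]]]]] := IH _ l_n0.
  by apply: nc_subseq nc_l; apply: subseq_rcons.
have [yx|ynx] := eqVneq y x.
  suff m3_0: m3 = [::].
    exists m1, k.+1, x, [::]; rewrite def_l m3_0 yx !cats0; split=> //.
    by rewrite rcons_cat -(cats1 (nseq _ _)) -[[:: x]]/(nseq 1 x) -nseqD addn1.
  case: m3 => [//|z m3] in def_l x3 sub31 *.
  have z1 : z \in m1 by apply: sub31; rewrite inE eqxx.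
  have zx : z = x.
    apply: nc_l; rewrite def_l yx rcons_cat rcons_cat.
    rewrite -[[:: z; _; _; _]]/([:: z] ++ [:: x] ++ [:: z; x]).
    rewrite cat_subseq ?sub1seq // cat_subseq ?sub1seq ?inE ?eqxx //.
    by rewrite rcons_cons /= eqxx sub1seq mem_rcons inE eqxx.
  by rewrite zx inE eqxx in x3.
have [y1|ny1] := boolP (y \in m1).
  exists m1, k, x, (rcons m3 y); split=> //.
  - by rewrite def_l !rcons_cat.
  - by rewrite mem_rcons inE eq_sym negb_or ynx.
  - by move=> z; rewrite mem_rcons inE => /predU1P[->|/sub31].
exists l, 0, y, [::]; split=> //; first by rewrite cats1.
rewrite def_l mem_cat negb_or ny1 mem_cat mem_nseq (negPf ynx) /=.
by apply: contra ny1 => /sub31.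
Qed.

(** The labels of [l2] occur only in one contiguous stretch, so a letter enclosed by two equal
    letters of [l2] lies in [l2] itself. Hence the two labels of a crossing are both in [l2] or both
    outside, and in the latter case deleting [l2] keeps the crossing. *)
Lemma nc_insert l1 l2 l3 : ~~ has (mem (l1 ++ l3)) l2 ->
  nc (l1 ++ l2 ++ l3) <-> nc l2 /\ nc (l1 ++ l3).
Proof.
move=> /hasPn dis; split=> [nc_l|[nc2 nc13] a b sub].
  split; first apply: nc_subseq nc_l.
    by rewrite (subseq_trans (prefix_subseq _ l3)) ?suffix_subseq.
  by apply: nc_subseq nc_l; rewrite cat_subseq ?suffix_subseq.
have dis1 c : c \in l2 -> c \notin l1.
  by move/dis; rewrite /= mem_cat negb_or => /andP[].
have dis3 c : c \in l2 -> c \notin l3.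
  by move/dis; rewrite /= mem_cat negb_or => /andP[].
have mid c d : c \in l2 -> subseq [:: c; d; c] (l1 ++ l2 ++ l3) -> d \in l2.
  move=> c2; rewrite subseq_catIr ?dis1 //.
  rewrite -[[:: c; d; c]]/(rcons [:: c; d] c) subseq_catIl ?dis3 //.
  by move/mem_subseq/(_ d); apply; rewrite !inE eqxx orbT.
have sub1 : subseq [:: a; b; a] (l1 ++ l2 ++ l3).
  exact: subseq_trans (prefix_subseq [:: a; b; a] [:: b]) sub.
have sub2 : subseq [:: b; a; b] (l1 ++ l2 ++ l3).
  by apply: subseq_trans sub; apply: subseq_cons.
have [a2|na2] := boolP (a \in l2).
  have b2 := mid _ _ a2 sub1.
  apply: nc2; move: sub; rewrite subseq_catIr ?dis1 //.
  by rewrite -[[:: a; b; a; b]]/(rcons [:: a; b; a] b) subseq_catIl ?dis3.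
have [b2|nb2] := boolP (b \in l2); first by rewrite (mid _ _ b2 sub2) in na2.
apply: nc13.
have : subseq [:: a; b; a; b] (seq.filter (predC (mem l2)) (l1 ++ l2 ++ l3)).
  by rewrite subseq_filter sub /= na2 nb2.
rewrite !filter_cat.
have -> : seq.filter (predC (mem l2)) l2 = [::].
  by apply/eqP; rewrite -(negbK (_ == _)) -has_filter; apply/hasPn => c /= ->.
by move=> /subseq_trans; apply; rewrite cat_subseq ?filter_subseq.
Qed.

Definition fibers n l : {set {set 'I_n}} :=
  preim_partition (fun i : 'I_n => nth 0 l i) [set: 'I_n].

Lemma fibers_partition n l : finset.partition (fibers n l) [set: 'I_n].
Proof. exact: preim_partitionP. Qed.

Lemma fibersP n l (V : {set 'I_n}) :
  reflect (exists i : 'I_n, V = [set j : 'I_n | nth 0 l i == nth 0 l j])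
          (V \in fibers n l).
Proof.
apply: (iffP imsetP) => [[i _ ->]|[i ->]]; exists i => //;
  by apply/setP => k; rewrite !inE.
Qed.

Lemma pblock_fibers n l (i : 'I_n) :
  finset.pblock (fibers n l) i = [set j : 'I_n | nth 0 l i == nth 0 l j].
Proof.
apply/setP => k; rewrite inE pblock_equivalence_partition ?inE //.
by move=> x y z _ _ _; split=> // /eqP ->.
Qed.

Lemma eq_fibers n l l' :
  (forall i k : 'I_n, (nth 0 l i == nth 0 l k) = (nth 0 l' i == nth 0 l' k)) ->
  fibers n l = fibers n l'.
Proof.
move=> eq_l; apply/setP => V; apply/fibersP/fibersP => -[i ->]; exists i;
  by apply/setP => k; rewrite !inE eq_l.
Qed.

Lemma fibers_map n (f : nat -> nat) l : size l = n -> {in l &, injective f} ->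
  fibers n (map f l) = fibers n l.
Proof.
move=> sz_l f_inj; apply: eq_fibers => i k.
by rewrite !(nth_map 0) ?sz_l // (inj_in_eq f_inj) // mem_nth ?sz_l.
Qed.

(** A canonical labelling, by the rank of the block among all subsets of ['I_n]. It is a section of
    [fibers]; in the other order the composite is the identity only up to an injective renaming of
    labels. *)
Definition block_labels n (pi : {set {set 'I_n}}) : seq nat :=
  [seq nat_of_ord (enum_rank (finset.pblock pi i)) | i <- enum 'I_n].

Lemma size_block_labels n (pi : {set {set 'I_n}}) : size (block_labels pi) = n.
Proof. by rewrite size_map size_enum_ord. Qed.

Lemma nth_block_labels n (pi : {set {set 'I_n}}) (i : 'I_n) :
  nth 0 (block_labels pi) i = enum_rank (finset.pblock pi i).
Proof. by rewrite (nth_map i) ?size_enum_ord // nth_ord_enum. Qed.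

Lemma fibers_block_labels n (pi : {set {set 'I_n}}) :
  finset.partition pi [set: 'I_n] -> fibers n (block_labels pi) = pi.
Proof.
move=> part_pi; rewrite -[RHS](preim_partition_pblock part_pi).
apply/setP => V; apply/imsetP/imsetP => -[i _ ->]; exists i => //;
  apply/setP => k; rewrite !inE !nth_block_labels;
  by rewrite -(inj_eq (@enum_rank_inj _)) -val_eqE.
Qed.

Lemma block_labels_fibers n l : size l = n ->
  exists2 f : nat -> nat, {in l &, injective f} &
    block_labels (fibers n l) = map f l.
Proof.
move=> sz_l.
(* A label is renamed to the rank of its level set. The level set of a label that occurs is
   nonempty, hence determines the label. *)
exists (fun x => nat_of_ord (enum_rank [set k : 'I_n | x == nth 0 l k])).
  move=> x y; rewrite -index_mem sz_l => lt_x _ /val_inj/enum_rank_inj/setP.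
  move/(_ (Ordinal lt_x)); rewrite !inE /= nth_index ?eqxx -?index_mem ?sz_l //.
  by move/esym/eqP.
apply: (@eq_from_nth _ 0); rewrite size_block_labels ?size_map // => i lt_i.
rewrite (nth_map 0) ?sz_l //.
by rewrite (nth_block_labels _ (Ordinal lt_i)) pblock_fibers.
Qed.

Lemma fibers_NC n l : size l = n -> fibers n l \in NC n <-> nc l.
Proof.
move=> sz_l; rewrite inE fibers_partition /=; split=> [ncP a b|nc_l].
  rewrite -{1}(drop0 l) => /subseq_dropP[i [_ _ ai]].
  move=> /subseq_dropP[i1 [lt_i1 _ bi1]] /subseq_dropP[i2 [lt_i2 _ ai2]].
  move=> /subseq_dropP[i3 [lt_i3 + bi3 _]]; rewrite sz_l => i3n.
  have i2n := ltn_trans lt_i3 i3n; have i1n := ltn_trans lt_i2 i2n.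
  have in_ := ltn_trans lt_i1 i1n.
  pose V := [set j : 'I_n | nth 0 l (Ordinal in_) == nth 0 l j].
  pose W := [set j : 'I_n | nth 0 l (Ordinal i1n) == nth 0 l j].
  have VP : V \in fibers n l by apply/fibersP; exists (Ordinal in_).
  have WP : W \in fibers n l by apply/fibersP; exists (Ordinal i1n).
  have /forallP/(_ V)/implyP/(_ VP)/forallP/(_ W)/implyP/(_ WP)/implyP := ncP.
  have H: [exists i in V, exists j in W, exists k in V, exists l in W,
     (i < j)%N && (j < k)%N && (k < l)%N].
    apply/existsP; exists (Ordinal in_); rewrite inE eqxx /=.
    apply/existsP; exists (Ordinal i1n); rewrite inE eqxx /=.
    apply/existsP; exists (Ordinal i2n); rewrite inE /= ai ai2 eqxx /=.
    apply/existsP; exists (Ordinal i3n); rewrite inE /= bi1 bi3 eqxx /=.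
    by rewrite lt_i1 lt_i2 lt_i3.
  move=> /(_ H) /eqP/setP/(_ (Ordinal i1n)).
  by rewrite !inE /= eqxx ai bi1 => /eqP.
apply/forallP => V; apply/implyP => /fibersP[v ->].
apply/forallP => W; apply/implyP => /fibersP[w ->].
apply/implyP => /existsP[i /andP[]]; rewrite inE => /eqP vi.
move=> /existsP[j /andP[]]; rewrite inE => /eqP wj.
move=> /existsP[k /andP[]]; rewrite inE => /eqP vk.
move=> /existsP[m /andP[]]; rewrite inE => /eqP wm /andP[/andP[ij jk] km].
suff -> : nth 0 l v = nth 0 l w by [].
apply: nc_l; rewrite -[X in subseq _ X]drop0.
apply/subseq_dropP; exists i; rewrite sz_l ltn_ord; split=> //.
apply/subseq_dropP; exists j; rewrite sz_l ltn_ord; split=> //.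
apply/subseq_dropP; exists k; rewrite sz_l ltn_ord; split=> //.
by apply/subseq_dropP; exists m; rewrite sz_l ltn_ord sub0seq; split.
Qed.

End LabelledPartitions.

(** * Removing an interval block, and joining partitions of an interval and of its complement *)

Section GapsAndJoins.
Local Open Scope nat_scope.
Local Open Scope set_scope.
Implicit Types (l t : seq nat) (a b x y z : nat).

Lemma insert_gapE p q r (V : {set 'I_(p + r)}) (k : 'I_(p + r))
    (i : 'I_(p + q + r)) :
  val i = (if k < p then k : nat else q + k) -> (i \in insert_gap q V) = (k \in V).
Proof.
move=> def_i; rewrite inE; apply/existsP/idP => [[k' /andP[k'V /eqP]]|kV].
  rewrite def_i => e; suff -> : k = k' by [].
  by apply: val_inj => /=; move: e; do 2 case: ifP => ?; lia.
by exists k; rewrite kV def_i eqxx.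
Qed.

Section RemoveInterval.
Variables (p q r : nat) (l1 l3 : seq nat) (x : nat).
Hypotheses (sz1 : size l1 = p) (sz3 : size l3 = r).
Hypotheses (x1 : x \notin l1) (x3 : x \notin l3) (q_gt0 : 0 < q).
Let L := l1 ++ nseq q x ++ l3.

Lemma nth_outside_gap k :
  nth 0 L (if k < p then k else q + k) = nth 0 (l1 ++ l3) k.
Proof.
rewrite /L !nth_cat sz1 size_nseq; case: (ltnP k p) => [->//|le_pk].
rewrite ltnNge (leq_trans le_pk) ?leq_addl //= ifF; last by lia.
by congr nth; lia.
Qed.

Lemma nth_inside_gap i : p <= i < p + q -> nth 0 L i = x.
Proof.
move=> /andP[le_pi lt_i]; rewrite /L !nth_cat sz1 size_nseq ltnNge le_pi /=.
by rewrite nth_nseq ltn_subLR // lt_i.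
Qed.

Lemma outside_gapP (i : 'I_(p + q + r)) : ~~ (p <= i < p + q) ->
  exists k : 'I_(p + r), val i = if k < p then k : nat else q + k.
Proof.
move=> i_out; have lt_i := ltn_ord i.
have [lt_ip|le_pi] := ltnP i p.
  have lt_k : i < p + r by lia.
  by exists (Ordinal lt_k); rewrite /= lt_ip.
have lt_k : i - q < p + r by lia.
exists (Ordinal lt_k) => /=; rewrite ifF; lia.
Qed.

Lemma gap_lt (k : 'I_(p + r)) :
  (if k < p then k : nat else q + k) < p + q + r.
Proof. by have := ltn_ord k; case: ifP; lia. Qed.

Lemma nth_notin_gap (k : 'I_(p + r)) : nth 0 (l1 ++ l3) k != x.
Proof.
apply/eqP => e; have : x \in l1 ++ l3.
  by rewrite -e mem_nth // size_cat sz1 sz3.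
by rewrite mem_cat (negPf x1) (negPf x3).
Qed.

Lemma interval_block_fibers : interval_block p q r \in fibers (p + q + r) L.
Proof.
have lt_p : p < p + q + r by lia.
apply/fibersP; exists (Ordinal lt_p); apply/setP => i; rewrite !inE.
rewrite [nth _ _ (Ordinal _)]nth_inside_gap /=; last by lia.
have [i_in|i_out] := boolP (p <= i < p + q).
  by rewrite nth_inside_gap ?eqxx.
have [k ->] := outside_gapP i_out; rewrite nth_outside_gap eq_sym.
by rewrite (negPf (nth_notin_gap k)).
Qed.

(** The increasing bijection onto the positions outside the interval preserves labels, so deleting
    the block deletes its run of [x] from the word. *)
Lemma remove_block_fibers :
  remove_block (fibers (p + q + r) L) = fibers (p + r) (l1 ++ l3).
Proof.
apply/setP => V; rewrite inE; apply/fibersP/fibersP => [[i defV]|[k defV]].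
  have : i \in insert_gap q V by rewrite defV inE.
  rewrite inE => /existsP[k /andP[kV /eqP def_i]].
  exists k; apply/setP => k'.
  rewrite -(@insert_gapE p q r V k' (Ordinal (gap_lt k'))) // defV !inE.
  by rewrite [val i]def_i /= !nth_outside_gap.
exists (Ordinal (gap_lt k)); apply/setP => i; rewrite [in RHS]inE /=.
rewrite nth_outside_gap; have [i_in|i_out] := boolP (p <= i < p + q).
  rewrite nth_inside_gap // (negPf (nth_notin_gap k)); apply/negbTE.
  rewrite inE; apply/existsP => -[k' /andP[_ /eqP]] /= e.
  by move: i_in; rewrite e; case: ifP => ?; lia.
have [k' def_i] := outside_gapP i_out.
by rewrite (insert_gapE _ def_i) defV inE def_i nth_outside_gap.
Qed.

End RemoveInterval.

Lemma fibers_const n l : 0 < n -> (forall i : 'I_n, nth 0 l i = head 0 l) ->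
  fibers n l = [set [set: 'I_n]].
Proof.
case: n => // n _ l_const; apply/setP => V; rewrite inE.
apply/fibersP/eqP => [[i ->]|->]; last exists ord0;
  by apply/setP => k; rewrite !inE !l_const eqxx.
Qed.

(** For the encoded partition this means that the positions [p, .., p + q - 1] form a union of
    blocks. *)
Definition saturated p q l := ~~ has (mem (take p l ++ drop (p + q) l)) (take q (drop p l)).

Lemma saturated_map (f : nat -> nat) p q l : {in l &, injective f} ->
  saturated p q (map f l) = saturated p q l.
Proof.
move=> f_inj; rewrite /saturated -map_take -!map_drop -map_take -map_cat.
congr (~~ _); rewrite has_map; apply: eq_in_has => x xl2 /=.
have xl : x \in l by apply: mem_drop (mem_take xl2).
apply/mapP/idP => [[y yl /f_inj -> //]|]; last by exists x.
by move: yl; rewrite mem_cat => /orP[/mem_take|/mem_drop].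
Qed.

(** Outer labels are made even and inner ones odd, so that no outer block merges with an inner
    one. *)
Definition join_partitions p q r (x : {set {set 'I_(p + r)}} * {set {set 'I_q}}) :=
  let l := map double (block_labels x.1) in
  fibers (p + q + r)
    (take p l ++ map (fun c => c.*2.+1) (block_labels x.2) ++ drop p l).

Definition split_partition p q r (pi : {set {set 'I_(p + q + r)}}) :
    {set {set 'I_(p + r)}} * {set {set 'I_q}} :=
  let l := block_labels pi in
  (fibers (p + r) (take p l ++ drop (p + q) l), fibers q (take q (drop p l))).

Lemma block_labels_nc n (pi : {set {set 'I_n}}) :
  pi \in NC n -> nc (block_labels pi).
Proof.
move=> piNC; apply/fibers_NC; rewrite ?size_block_labels //.
by rewrite fibers_block_labels //; move: piNC; rewrite inE => /andP[].
Qed.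

(** The two renamings glue to a single one, injective because its values on outer and inner labels
    differ in parity. *)
Lemma fibers_parity n (f g : nat -> nat) l1 l2 l3 :
  {in l1 ++ l3 &, injective f} -> {in l2 &, injective g} ->
  ~~ has (mem (l1 ++ l3)) l2 -> size (l1 ++ l2 ++ l3) = n ->
  fibers n ([seq (f c).*2 | c <- l1] ++ [seq (g c).*2.+1 | c <- l2] ++
            [seq (f c).*2 | c <- l3]) = fibers n (l1 ++ l2 ++ l3).
Proof.
move=> f_inj g_inj /hasPn dis sz_l.
pose h c := if c \in l2 then (g c).*2.+1 else (f c).*2.
have h13 c : c \in l1 ++ l3 -> h c = (f c).*2.
  by rewrite /h; case: ifP => // /dis /negP.
rewrite -[RHS](@fibers_map n h) // => [|a b].
  rewrite !map_cat; congr (fibers n (_ ++ _ ++ _)); apply/eq_in_map => c c_in.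
  - by rewrite h13 // mem_cat c_in.
  - by rewrite /h c_in.
  - by rewrite h13 // mem_cat c_in orbT.
have in13 c : c \in l1 ++ l2 ++ l3 -> c \notin l2 -> c \in l1 ++ l3.
  by rewrite !mem_cat => /or3P[->|->|->]; rewrite ?orbT.
rewrite /h => al bl; case: ifP => a2; case: ifP => b2 e.
- by apply: g_inj => //; lia.
- lia.
- lia.
- by apply: f_inj; rewrite ?in13 ?a2 ?b2 //; lia.
Qed.

Lemma split_partitionK p q r (pi : {set {set 'I_(p + q + r)}}) :
  pi \in NC (p + q + r) -> saturated p q (block_labels pi) ->
  join_partitions (split_partition pi) = pi /\
  split_partition pi \in finset.setX (NC (p + r)) (NC q).
Proof.
move=> piNC; have nc_l := block_labels_nc piNC.
have part_pi : finset.partition pi [set: 'I_(p + q + r)].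
  by move: piNC; rewrite inE => /andP[].
move: nc_l; rewrite /saturated /split_partition.
have := size_block_labels pi; have := fibers_block_labels part_pi.
set l := block_labels pi => def_pi sz_l.
set l1 := take p l; set l2 := take q (drop p l); set l3 := drop (p + q) l.
have def_l : l = l1 ++ l2 ++ l3.
  by rewrite /l3 addnC -drop_drop !cat_take_drop.
have sz1 : size l1 = p by rewrite size_takel // sz_l; lia.
have sz2 : size l2 = q by rewrite size_takel // size_drop sz_l; lia.
have sz3 : size l3 = r by rewrite size_drop sz_l; lia.
have sz13 : size (l1 ++ l3) = p + r by rewrite size_cat sz1 sz3.
rewrite def_l => nc_l dis; have [nc2 nc13] := (nc_insert dis).1 nc_l.
split; last by rewrite finset.in_setX; apply/andP; split; apply/fibers_NC.
have [f f_inj lab_f] := block_labels_fibers sz13.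
have [g g_inj lab_g] := block_labels_fibers sz2.
rewrite /join_partitions /= lab_f lab_g -!map_comp -map_take -map_drop.
rewrite take_size_cat // drop_size_cat //.
rewrite -[RHS]def_pi def_l; apply: (@fibers_parity _ f g) => //.
by rewrite !size_cat sz1 sz2 sz3; lia.
Qed.

(** The last clause recovers the outer labels up to an injective renaming. It transports conditions
    on the outer partition, such as [head_block], through the join. *)
Lemma join_partitionsK p q r (x : {set {set 'I_(p + r)}} * {set {set 'I_q}}) :
  x \in finset.setX (NC (p + r)) (NC q) ->
  [/\ split_partition (join_partitions x) = x,
      join_partitions x \in NC (p + q + r),
      saturated p q (block_labels (join_partitions x)) &
      exists2 f : nat -> nat, {in block_labels x.1 &, injective f} &
        let l := block_labels (join_partitions x) in
        take p l ++ drop (p + q) l = map f (block_labels x.1)].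
Proof.
case: x => pi sigma; rewrite finset.in_setX /= => /andP[piNC sigNC].
have nc_l := block_labels_nc piNC; have nc2 := block_labels_nc sigNC.
have part_pi : finset.partition pi [set: 'I_(p + r)].
  by move: piNC; rewrite inE => /andP[].
have part_sig : finset.partition sigma [set: 'I_q].
  by move: sigNC; rewrite inE => /andP[].
rewrite /join_partitions /split_partition /=.
have := size_block_labels pi; have := fibers_block_labels part_pi.
have := size_block_labels sigma; have := fibers_block_labels part_sig.
move: nc2 nc_l; move: (block_labels sigma) (block_labels pi) => l2 l.
move=> nc2 nc_l def_sig sz2 def_pi sz_l.
rewrite -map_take -map_drop; set L := _ ++ _ ++ _.
have dbl_inj : injective double by move=> a b; lia.
have sz1 : size (map double (take p l)) = p.
  by rewrite size_map size_takel // sz_l; lia.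
have szL : size L = p + q + r.
  by rewrite !size_cat sz1 !size_map sz2 size_drop sz_l; lia.
have [k k_inj ->] := block_labels_fibers szL.
have catL : take p L ++ drop (p + q) L = map double l.
  rewrite /L take_size_cat // addnC -drop_drop drop_size_cat //.
  by rewrite drop_size_cat ?size_map // -map_cat cat_take_drop.
have subL : {subset map double l <= L}.
  by move=> c; rewrite -catL mem_cat => /orP[/mem_take|/mem_drop].
have midL : take q (drop p L) = [seq c.*2.+1 | c <- l2].
  by rewrite /L drop_size_cat // take_size_cat ?size_map.
have satL : saturated p q L.
  rewrite /saturated catL midL; apply/hasPn => c /mapP[d _ ->] /=.
  by apply/mapP => -[e _]; lia.
split.
- congr pair; rewrite -?map_drop -!map_take -?map_cat.
    rewrite catL -map_comp fibers_map // => a b al bl /= e.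
    by apply/dbl_inj/k_inj => //; apply/subL/map_f.
  rewrite midL -map_comp fibers_map // => a b al bl /= e.
  suff /eqP : a.*2.+1 = b.*2.+1 by rewrite eqSS => /eqP/dbl_inj.
  by apply: k_inj => //; rewrite /L !mem_cat map_f ?orbT.
- apply/fibers_NC => //; apply/nc_insert.
    by move: satL; rewrite /saturated catL midL -map_cat cat_take_drop.
  rewrite -map_cat cat_take_drop !nc_map //.
    by move=> a b _ _; apply: dbl_inj.
  by move=> a b _ _; lia.
- by rewrite saturated_map.
- exists (k \o double) => [a b al bl /= e|].
    by apply/dbl_inj/k_inj => //; apply/subL/map_f.
  by rewrite /= -map_drop -map_take -map_cat catL -map_comp.
Qed.

(** By the two preceding lemmas, joining and splitting are inverse bijections between the saturated
    non-crossing partitions and the pairs in NC(p + r) x NC(q). *)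
Lemma sum_saturated (V : nmodType) p q r
    (C : pred {set {set 'I_(p + q + r)}}) (F : {set {set 'I_(p + q + r)}} -> V) :
  (\sum_(pi in NC (p + q + r) | saturated p q (block_labels pi) && C pi) F pi =
   \sum_(x in finset.setX (NC (p + r)) (NC q) | C (join_partitions x))
     F (join_partitions x))%R.
Proof.
rewrite (reindex_onto (@join_partitions p q r) (@split_partition p q r)) /=.
  apply: eq_bigl => x.
  have [xNC|xnNC] := boolP (x \in finset.setX _ _).
    by have [-> -> -> _] := join_partitionsK xNC; rewrite eqxx andbT.
  apply/negP => /andP[/and3P[jNC jsat _] /eqP jK].
  by have [_] := split_partitionK jNC jsat; rewrite jK (negPf xnNC).
by move=> pi /and3P[piNC pi_sat _]; have [] := split_partitionK piNC pi_sat.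
Qed.

End GapsAndJoins.

(** * The block of the first position, scanned from left to right *)

Section HeadBlock.
Local Open Scope nat_scope.
Implicit Types (l : seq nat).

(** State of the scan: the first [p] positions are in the block of position 0, and the following [q]
    form a gap of positions already known to lie outside it. *)
Definition head_block p q l :=
  all (pred1 (head 0 l)) (take p l) && (head 0 l \notin take q (drop p l)).

Lemma head_block_map (f : nat -> nat) p q l : {in l &, injective f} ->
  head_block p q (map f l) = head_block p q l.
Proof.
have [->//|l_n0 f_inj] := eqVneq l [::].
have [zl hd] : head 0 l \in l /\ head 0 (map f l) = f (head 0 l).
  by case: l l_n0 {f_inj} => // z l _; rewrite inE eqxx.
rewrite /head_block hd -map_drop -!map_take all_map.
congr (_ && ~~ _).
  apply: eq_in_all => x /mem_take xl /=.
  by apply/eqP/eqP => [/f_inj->|->].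
apply/mapP/idP => [[x x_in fzx]|]; last by exists (head 0 l).
by rewrite (f_inj _ x zl _ fzx) //; apply: mem_drop (mem_take x_in).
Qed.

Lemma head_blockSr p q l : p + q < size l ->
  head_block p q.+1 l = head_block p q l && (nth 0 l (p + q) != head 0 l).
Proof.
move=> lt_l; rewrite /head_block -andbA; congr (_ && _).
rewrite (take_nth 0) ?nth_drop; last by rewrite size_drop; lia.
by rewrite mem_rcons inE negb_or andbC eq_sym.
Qed.

Lemma head_blockSl p l : p < size l ->
  head_block p.+1 0 l = head_block p 0 l && (nth 0 l p == head 0 l).
Proof.
by move=> lt_l; rewrite /head_block !take0 !andbT (take_nth 0) // all_rcons andbC.
Qed.

(** Let [z] be the label of the first block. If the gap is followed by [z], a gap label [y]
    recurring later would give the crossing [z y z y]; before the gap only [z] occurs. So the gap is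
    a union of blocks. The number [0 < r], read as 0 or 1, drops the condition on the next letter
    when the gap ends the word. *)
Lemma head_block_saturated p q r l : nc l -> size l = p + q + r -> 0 < p ->
  head_block p q l && all (pred1 (head 0 l)) (take (0 < r) (drop (p + q) l)) =
  saturated p q l && head_block (p + (0 < r)) 0 (take p l ++ drop (p + q) l).
Proof.
rewrite /head_block /saturated.
set l1 := take p l; set l2 := take q (drop p l); set l3 := drop (p + q) l.
move=> + sz_l p_gt0; have def_l : l = l1 ++ l2 ++ l3.
  by rewrite /l3 addnC -drop_drop !cat_take_drop.
have sz1 : size l1 = p by rewrite size_takel // sz_l; lia.
have sz3 : size l3 = r by rewrite size_drop sz_l; lia.
rewrite def_l take0 andbT take_cat sz1 [_ + _ < p]ltnNge leq_addr addKn /=.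
clearbody l1 l2 l3; case: l1 => [|z l1] in sz1 def_l *; first by rewrite -sz1 in p_gt0.
move=> nc_l; rewrite all_cat /= eqxx /=.
apply/andP/and3P => [[/andP[all1 z2] all3]|[sat all1 all3]]; split=> //.
  apply/hasPn => y y2; rewrite /= inE mem_cat !negb_or.
  have yz : y != z by apply: contraNneq z2 => <-.
  rewrite yz /=; apply/andP; split; first by apply: contra yz => /(allP all1).
  case: l3 => [//|z' l3] in sz3 all3 def_l nc_l *.
  move: all3; rewrite -sz3 /= take0 andbT => /eqP zz'; subst z'.
  rewrite inE negb_or yz /=.
  apply: contraNN yz => y3; apply/eqP/esym/nc_l => /=; rewrite eqxx.
  rewrite -[[:: y; z; y]]/([::] ++ [:: y] ++ [:: z; y]) cat_subseq ?sub0seq //.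
  by rewrite cat_subseq ?sub1seq //= eqxx sub1seq.
rewrite all1 /=; apply: contra sat => z2; apply/hasP; exists z => //=.
by rewrite inE eqxx.
Qed.

End HeadBlock.

(** * Multiplying into the argument that precedes a gap *)

Section RightMultiplication.
Variables (R : realType) (M : vNalgebra R).
Implicit Types (u v : seq M) (b x y : M).

Definition rmul_seq u b : seq M :=
  if u is y :: u' then rcons (belast y u') (last y u' * b) else [::].

Lemma rmul_seq_rcons u y b : rmul_seq (rcons u y) b = rcons u (y * b).
Proof. by case: u => //= z u; rewrite belast_rcons last_rcons. Qed.

Lemma rmul_seq_cat u v b : v != [::] -> rmul_seq (u ++ v) b = u ++ rmul_seq v b.
Proof. by case/lastP: v => // v y _; rewrite -rcons_cat !rmul_seq_rcons rcons_cat. Qed.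

Lemma size_rmul_seq u b : size (rmul_seq u b) = size u.
Proof. by case: u => // y u; rewrite size_rcons size_belast. Qed.

Lemma rmul_seq_cat_neq0 u v b : u != [::] -> rmul_seq u b ++ v != [::].
Proof. by case: u => // y u _ /=; case: (belast y u). Qed.

(** Complements [rmul_seq]: when [u] is empty, the argument just before the gap is [xi] itself.
    Together they multiply [b] into whichever argument comes last before the gap. *)
Definition rmul_first (X : Type) (ract : M -> X -> X) u b (xi : X) : X :=
  if u is [::] then ract b xi else xi.

Lemma rmul_first_cat (X : Type) (ract : M -> X -> X) u v b xi :
  v != [::] -> rmul_first ract (u ++ v) b xi = xi.
Proof. by case: u v => [|? ?] []. Qed.

End RightMultiplication.

(* The common structure of the cumulants of elements of M, with
   X = V = M, and of those with a first argument in L^2, with X = V = L^2. *)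
Record block_cumulants (R : realType) (M : vNalgebra R) (B : set M)
    (kappa : seq M -> M) (X : Type) (V : zmodType)
    (ract : M -> X -> X) (vact : M -> V -> V)
    (K : X -> seq M -> V)
    (K_part : forall n, {set {set 'I_n}} -> X -> seq M -> V) : Prop := {
  vact1 : forall v, vact 1 v = v;
  vactDl : forall a b v, vact (a + b) v = vact a v + vact b v;
  vactDr : forall b v w, vact b (v + w) = vact b v + vact b w;
  blockD : forall xi u x y w,
    K xi (u ++ (x + y) :: w) = K xi (u ++ x :: w) + K xi (u ++ y :: w);
  block_balanced : forall b xi u y w, B b ->
    K (rmul_first ract u b xi) (rmul_seq u b ++ y :: w) = K xi (u ++ b * y :: w);
  block_right : forall b xi u, B b ->
    K (rmul_first ract u b xi) (rmul_seq u b) = vact b (K xi u);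
  block_one : forall xi s, K_part (size s).+1 [set [set: 'I_(size s).+1]]%SET xi s = K xi s;
  block_interval : forall xi u v w
      (pi : {set {set 'I_((size u).+1 + size v + size w)}}),
    pi \in NC _ -> v <> [::] -> interval_block _ _ _ \in pi ->
    K_part _ pi xi (u ++ v ++ w) =
    K_part _ (remove_block pi)
      (rmul_first ract u (kappa v) xi) (rmul_seq u (kappa v) ++ w)
}.

(** * Evaluating multiplicative extensions by peeling off interval blocks *)

Section BlockRecursion.
Variables (R : realType) (M : vNalgebra R) (B : set M) (E : {linear M -> M}).
Variables (kappa : seq M -> M) (kappa_part : forall n, {set {set 'I_n}} -> seq M -> M).
Hypothesis hkappa : cumulants B E kappa kappa_part.

Lemma kappa_part_interval n m (l1 l3 : seq nat) c u v w :
    n = (size u + size v + size w)%N -> m = (size u + size w)%N ->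
    size l1 = size u -> size l3 = size w -> u != [::] -> v != [::] ->
    c \notin l1 -> c \notin l3 -> nc (l1 ++ nseq (size v) c ++ l3) ->
  kappa_part (fibers n (l1 ++ nseq (size v) c ++ l3)) (u ++ v ++ w) =
  kappa_part (fibers m (l1 ++ l3)) (rmul_seq u (kappa v) ++ w).
Proof.
case/lastP: u => // u x -> -> sz1 sz3 _ v0 c1 c3 nc_l.
have v_gt0 : (0 < size v)%N by rewrite lt0n size_eq0.
rewrite -(remove_block_fibers sz1 sz3 c1 c3 v_gt0) rmul_seq_rcons.
have := interval_block_fibers sz1 sz3 c1 c3 v_gt0.
have : fibers (size (rcons u x) + size v + size w) (l1 ++ nseq (size v) c ++ l3) \in NC _.
  by apply/fibers_NC => //; rewrite !size_cat size_nseq sz1 sz3 addnA.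
move: (fibers _ _); rewrite size_rcons => pi piNC pi_in.
by apply: kappa_inner_block hkappa _ _ _ _ _ piNC _ pi_in => /eqP; apply/negP.
Qed.

Lemma kappa_part_one n c v : n = size v -> v != [::] ->
  kappa_part (fibers n (nseq (size v) c)) v = kappa v.
Proof.
move=> -> v0; have v_gt0 : (0 < size v)%N by rewrite lt0n size_eq0.
rewrite fibers_const // => [|i]; last first.
  by case: (size v) i => [[]|k i] //; rewrite nth_nseq ltn_ord.
by apply: (kappa_one_block hkappa) => /eqP; apply/negP.
Qed.

(** Prepares inductions that peel off the block with the largest minimum. Unless it is the only
    block, [v1] is nonempty, so its cumulant can be multiplied into a letter on its left. *)
Lemma last_block_cut l (v : seq M) : nc l -> size l = size v -> v != [::] ->
  (exists c, l = nseq (size v) c) \/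
  exists m1 m3 c v1 v2 v3, [/\ l = m1 ++ nseq (size v2) c ++ m3,
    v = v1 ++ v2 ++ v3, size m1 = size v1, size m3 = size v3 &
    [/\ c \notin m1, c \notin m3, v1 != [::] & v2 != [::]]].
Proof.
move=> nc_l sz_l v0; have l0 : l != [::] by rewrite -size_eq0 sz_l size_eq0.
have [m1 [k [c [m3 [def_l c1 c3 sub31]]]]] := nc_last_block nc_l l0.
have [m1_0|m1_n0] := eqVneq m1 [::].
  left; exists c; have m3_0 : m3 = [::].
    case: m3 sub31 {def_l c3} => // d m3 /(_ d).
    by rewrite m1_0 inE eqxx => /(_ isT).
  by rewrite -sz_l def_l m1_0 m3_0 cats0 /= size_nseq.
right; have sz_v : size v = (size m1 + (k.+1 + size m3))%N.
  by rewrite -sz_l def_l !size_cat size_nseq.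
exists m1, m3, c, (take (size m1) v), (take k.+1 (drop (size m1) v)),
  (drop k.+1 (drop (size m1) v)).
have sz2 : size (take k.+1 (drop (size m1) v)) = k.+1.
  by rewrite size_takel // size_drop sz_v; lia.
have sz1 : size (take (size m1) v) = size m1 by rewrite size_takel // sz_v; lia.
rewrite sz1 sz2 !cat_take_drop !size_drop sz_v; split=> //; first by lia.
by split=> //; rewrite -size_eq0 ?sz1 ?sz2 ?size_eq0.
Qed.

(** Peeling off interval blocks shortens the word and ends in a single cumulant, which lies in
    [B]. *)
Lemma kappa_part_in n l v : nc l -> size l = size v -> v != [::] -> n = size v ->
  B (kappa_part (fibers n l) v).
Proof.
have [k] := ubnP (size v); elim: k l v n => // k IH l v n lt_v nc_l sz_l v0 def_n.
case: (last_block_cut nc_l sz_l v0) => [[c ->]|].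
  by rewrite kappa_part_one //; apply: (kappa_in hkappa) => /eqP; apply/negP.
move=> [m1 [m3 [c [v1 [v2 [v3 [def_l def_v sz1 sz3 [c1 c3 v1_0 v2_0]]]]]]]].
have v2_gt0 : (0 < size v2)%N by case: (v2) v2_0.
have v1_gt0 : (0 < size v1)%N by case: (v1) v1_0.
rewrite def_v !size_cat in lt_v; rewrite def_l in nc_l.
rewrite def_v def_l (@kappa_part_interval _ (size v1 + size v3)) //.
  apply: IH; rewrite ?size_cat ?size_rmul_seq ?sz1 ?sz3 //.
    move: lt_v v2_gt0; move: (size v1) (size v2) (size v3) => a b d; lia.
    by apply: nc_subseq nc_l; rewrite cat_subseq // suffix_subseq.
  exact: rmul_seq_cat_neq0.
by rewrite def_n def_v !size_cat addnA.
Qed.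

Variables (X : Type) (V : zmodType) (ract : M -> X -> X) (vact : M -> V -> V).
Variables (K : X -> seq M -> V) (K_part : forall n, {set {set 'I_n}} -> X -> seq M -> V).
Hypothesis hK : block_cumulants B kappa ract vact K K_part.

Lemma block_interval_fibers n m (l1 l3 : seq nat) c xi u v w :
    n = ((size u).+1 + size v + size w)%N -> m = ((size u).+1 + size w)%N ->
    size l1 = (size u).+1 -> size l3 = size w -> v != [::] ->
    c \notin l1 -> c \notin l3 -> nc (l1 ++ nseq (size v) c ++ l3) ->
  K_part (fibers n (l1 ++ nseq (size v) c ++ l3)) xi (u ++ v ++ w) =
  K_part (fibers m (l1 ++ l3))
    (rmul_first ract u (kappa v) xi) (rmul_seq u (kappa v) ++ w).
Proof.
move=> -> -> sz1 sz3 v0 c1 c3 nc_l.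
have v_gt0 : (0 < size v)%N by rewrite lt0n size_eq0.
rewrite -(remove_block_fibers sz1 sz3 c1 c3 v_gt0).
apply: (block_interval hK); last exact: interval_block_fibers.
  by apply/fibers_NC => //; rewrite !size_cat size_nseq sz1 sz3 addnA.
by apply/eqP.
Qed.

(** The last block of the inserted partition is an interval of the whole word as well, so peeling it
    off is the same step in [b] and in [K_part]. Induction on [size v] leaves a single block. *)
Lemma block_insert n m q (l1 l2 l3 : seq nat) xi u v w :
    n = ((size u).+1 + size v + size w)%N -> m = ((size u).+1 + size w)%N ->
    q = size v ->
    size l1 = (size u).+1 -> size l2 = size v -> size l3 = size w -> v != [::] ->
    ~~ has (mem (l1 ++ l3)) l2 -> nc (l1 ++ l2 ++ l3) ->
  let b := kappa_part (fibers q l2) v in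
  K_part (fibers n (l1 ++ l2 ++ l3)) xi (u ++ v ++ w) =
  K_part (fibers m (l1 ++ l3)) (rmul_first ract u b xi) (rmul_seq u b ++ w).
Proof.
have [k] := ubnP (size v).
elim: k l2 v n q => // k IH l2 v n q lt_v def_n def_m def_q sz1 sz2 sz3 v0 dis nc_l.
have [nc2 nc13] := (nc_insert dis).1 nc_l => /=.
case: (last_block_cut nc2 sz2 v0) => [[c def_l2]|].
  rewrite def_l2 in dis nc_l *; rewrite kappa_part_one //.
  have : c \notin l1 ++ l3.
    apply: contra dis => c13; apply/hasP; exists c => //.
    by rewrite mem_nseq eqxx lt0n size_eq0 v0.
  rewrite mem_cat negb_or => /andP[c1 c3].
  exact: block_interval_fibers.
move=> [m1 [m3 [c [v1 [v2 [v3 [def_l2 def_v sz_m1 sz_m3 [c1 c3 v1_0 v2_0]]]]]]]].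
have v2_gt0 : (0 < size v2)%N by case: (v2) v2_0.
have v1_gt0 : (0 < size v1)%N by case: (v1) v1_0.
have c_l2 : c \in l2 by rewrite def_l2 !mem_cat mem_nseq eqxx v2_gt0 orbT.
have : c \notin l1 ++ l3 by move/hasPn: dis; apply.
rewrite mem_cat negb_or => /andP[cl1 cl3].
have szv : size v = (size v1 + size v2 + size v3)%N by rewrite def_v !size_cat addnA.
have dis' : ~~ has (mem (l1 ++ l3)) (m1 ++ m3).
  apply: contra dis => /hasP[d d13 dl]; apply/hasP; exists d => //.
  by rewrite def_l2; move: d13; rewrite !mem_cat => /orP[->|->]; rewrite ?orbT.
have nc2' : nc (m1 ++ m3).
  by apply: nc_subseq nc2; rewrite def_l2 cat_subseq // suffix_subseq.
have nc_l' : nc (l1 ++ (m1 ++ m3) ++ l3) by apply/nc_insert.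
rewrite [in kappa_part _ v]def_v def_l2.
rewrite (@kappa_part_interval _ (size v1 + size v3)) //; last first.
- by rewrite -def_l2.
- by rewrite def_q szv.
have sz_v' : size (rmul_seq v1 (kappa v2) ++ v3) = (size v1 + size v3)%N.
  by rewrite size_cat size_rmul_seq.
rewrite -(IH (m1 ++ m3) _ ((size u).+1 + (size v1 + size v3) + size w)%N) ?sz_v' //.
- rewrite def_v -!catA !(catA l1) (catA u v1).
  rewrite (@block_interval_fibers _ ((size (u ++ v1)).+1 + size (v3 ++ w))) //.
  + rewrite rmul_first_cat // rmul_seq_cat // -!catA.
    suff -> : ((size (u ++ v1)).+1 + size (v3 ++ w) =
      (size u).+1 + (size v1 + size v3) + size w)%N by [].
    by rewrite !size_cat !addSn !addnA.
  + by rewrite def_n szv !size_cat !addSn !addnA.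
  + by rewrite !size_cat sz1 sz_m1.
  + by rewrite !size_cat sz3 sz_m3.
  + by rewrite mem_cat negb_or cl1.
  + by rewrite mem_cat negb_or c3.
  + by move: nc_l; rewrite def_l2 -!catA.
- rewrite szv in lt_v; move: lt_v v2_gt0.
  by move: (size v1) (size v2) (size v3) => a b d; lia.
- by rewrite size_cat sz_m1 sz_m3.
- exact: rmul_seq_cat_neq0.
Qed.

End BlockRecursion.

(** * The moment-cumulant recursion *)

Section GapSum.
Variables (R : realType) (M : vNalgebra R) (E : {linear M -> M}).

(* The sum of K t e over all subwords t of s, where every letter of t has been
   multiplied on the left by the expectation of the letters skipped just
   before it, g being skipped before s, and where e is the expectation of the
   letters skipped at the end. Letters carry tags in C. *)
Fixpoint gap_sum (C : eqType) (V : nmodType) (K : seq (M * C) -> M -> V)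
    (g : seq M) (s : seq (M * C)) : V :=
  if s is (a, c) :: s' then
    gap_sum (fun t e => K ((E (\prod_(x <- g) x) * a, c) :: t) e) [::] s' +
    gap_sum K (rcons g a) s'
  else K [::] (E (\prod_(x <- g) x)).

(** Kernels are compared only on words with letters in [P]. Since [gap_sum] multiplies letters by
    expectations, [P] must be stable under this. *)
Lemma eq_gap_sum_in (C : eqType) (V : nmodType) (P : M * C -> Prop) (B : set M)
    (K K' : seq (M * C) -> M -> V) g s :
    (forall y, B (E y)) -> (forall a c y, P (a, c) -> P (E y * a, c)) ->
    (forall x, x \in s -> P x) ->
    (forall t e, (size t <= size s)%N ->
      (forall x, x \in t -> P x) -> B e -> K t e = K' t e) ->
  gap_sum K g s = gap_sum K' g s.
Proof.
move=> BE PE; elim: s K K' g => [|[a c] s IH] K K' g Ps eqK /=; first exact: eqK.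
have Pac : P (a, c) by apply: Ps; rewrite mem_head.
have Ps' x : x \in s -> P x by move=> xs; apply: Ps; rewrite in_cons xs orbT.
congr (_ + _); apply: IH => // t e le_t Pt Be; apply: eqK => //.
  by move=> x; rewrite in_cons => /predU1P[->|/Pt]; first exact: PE.
exact: leqW.
Qed.

Lemma eq_gap_sum (C : eqType) (V : nmodType) (K K' : seq (M * C) -> M -> V) g s :
  (forall t y, K t (E y) = K' t (E y)) -> gap_sum K g s = gap_sum K' g s.
Proof.
move=> eqK; apply: (@eq_gap_sum_in _ _ (fun=> True) (range E)) => //.
by move=> t e _ _ [y _ <-].
Qed.

Lemma gap_sum_sum (C : eqType) (V : nmodType) (I : finType) (P : pred I)
    (K : I -> seq (M * C) -> M -> V) g s :
  \sum_(i | P i) gap_sum (K i) g s = gap_sum (fun t e => \sum_(i | P i) K i t e) g s.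
Proof.
elim: s K g => [|[a c] s IH] K g //=.
by rewrite big_split /= !IH.
Qed.

End GapSum.

(** * Summation over the block of the first argument *)

Section GapRecursion.
Variables (R : realType) (M : vNalgebra R) (B : set M) (E : {linear M -> M}).
Hypothesis hE : conditional_expectation B E.
Variables (kappa : seq M -> M) (kappa_part : forall n, {set {set 'I_n}} -> seq M -> M).
Hypothesis hkappa : cumulants B E kappa kappa_part.
Variables (X : Type) (V : zmodType) (ract : M -> X -> X) (vact : M -> V -> V).
Variables (K : X -> seq M -> V) (K_part : forall n, {set {set 'I_n}} -> X -> seq M -> V).
Hypothesis hK : block_cumulants B kappa ract vact K K_part.

Lemma block_join xi u v w
    (x : {set {set 'I_((size u).+1 + size w)}} * {set {set 'I_(size v)}}) :
    x \in finset.setX (NC _) (NC _) -> v != [::] ->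
  let b := kappa_part x.2 v in
  K_part (join_partitions x) xi (u ++ v ++ w) =
  K_part x.1 (rmul_first ract u b xi) (rmul_seq u b ++ w).
Proof.
case: x => pi sigma; rewrite finset.in_setX /= => /andP[piNC sigNC] v0.
have nc_l := block_labels_nc piNC; have nc2 := block_labels_nc sigNC.
have part_pi : finset.partition pi [set: 'I_((size u).+1 + size w)]%SET.
  by move: piNC; rewrite inE => /andP[].
have part_sig : finset.partition sigma [set: 'I_(size v)]%SET.
  by move: sigNC; rewrite inE => /andP[].
rewrite /join_partitions /=.
have dbl_inj : injective double by move=> a b; lia.
have odd_inj : injective (fun c : nat => c.*2.+1) by move=> a b; lia.
have dis : ~~ has (mem (map double (block_labels pi)))
    [seq c.*2.+1 | c <- block_labels sigma].
  by apply/hasPn => c /mapP[d _ ->] /=; apply/mapP => -[e _]; lia.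
rewrite (block_insert hkappa hK xi (m := ((size u).+1 + size w)%N) (q := size v)) //.
- rewrite cat_take_drop !fibers_map ?size_block_labels //; try by move=> a b _ _; auto.
  by rewrite !fibers_block_labels.
- by rewrite size_takel // size_map size_block_labels leq_addr.
- by rewrite size_map size_block_labels.
- by rewrite size_drop size_map size_block_labels addKn.
- by rewrite cat_take_drop.
- apply/nc_insert; rewrite ?cat_take_drop //.
  by rewrite !nc_map; try by move=> a b _ _; auto.
Qed.

(** Once the gap [v] is closed by a letter of the first block or by the end of the word, a partition
    amounts to independent choices on the gap and off it. Summing over the choice on the gap later
    produces [E] of its product. *)
Lemma sum_blocks xi u v w : v != [::] ->
  let p := (size u).+1 in let q := size v in let r := size w in
  \sum_(pi in NC (p + q + r) | head_block p q (block_labels pi) &&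
      all (pred1 (head 0%N (block_labels pi)))
        (take (0 < r)%N (drop (p + q) (block_labels pi))))
     K_part pi xi (u ++ v ++ w) =
  \sum_(sigma in NC q)
    \sum_(pi in NC (p + r) | head_block (p + (0 < r)) 0 (block_labels pi))
      K_part pi (rmul_first ract u (kappa_part sigma v) xi)
        (rmul_seq u (kappa_part sigma v) ++ w).
Proof.
move=> v0 p q r.
transitivity (\sum_(pi in NC (p + q + r) | saturated p q (block_labels pi) &&
    head_block (p + (0 < r)) 0 (take p (block_labels pi) ++ drop (p + q) (block_labels pi)))
    K_part pi xi (u ++ v ++ w)).
  apply: eq_bigl => pi; have [piNC|//] := boolP (pi \in NC _).
  by rewrite head_block_saturated ?size_block_labels //; apply: block_labels_nc.
rewrite (@sum_saturated _ p q r (fun pi => head_block (p + (0 < r)) 0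
  (take p (block_labels pi) ++ drop (p + q) (block_labels pi)))).
rewrite exchange_big pair_big /=.
apply: eq_big => [[pi sigma]|x /andP[xNC _]]; last exact: block_join.
have [xNC|] := boolP ((pi, sigma) \in finset.setX _ _); last first.
  by rewrite finset.in_setX /= => /negPf; case: (_ \in _) => //= ->; rewrite andbF.
have [_ _ _ [f f_inj /= ->]] := join_partitionsK xNC.
rewrite head_block_map //; move: xNC; rewrite finset.in_setX => /andP[-> ->].
by rewrite andbT.
Qed.

Lemma expectation_sum_cumulants v : v != [::] ->
  E (\prod_(x <- v) x) = \sum_(sigma in NC (size v)) kappa_part sigma v.
Proof. by move/eqP/(moment_cumulant hkappa). Qed.

Lemma kappa_part_NC_in v (sigma : {set {set 'I_(size v)}}) :
  v != [::] -> sigma \in NC (size v) -> B (kappa_part sigma v).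
Proof.
move=> v0 sigNC; have := block_labels_nc sigNC.
move: sigNC; rewrite inE => /andP[part_s _] nc_s.
rewrite -(fibers_block_labels part_s).
by apply: (kappa_part_in hkappa nc_s); rewrite ?size_block_labels.
Qed.

Lemma sum_one_block n xi s : n = (size s).+1 ->
  \sum_(pi in NC n | head_block n 0 (block_labels pi)) K_part pi xi s = K xi s.
Proof.
move=> def_n; have n_gt0 : (0 < n)%N by rewrite def_n.
have one_fib : [set [set: 'I_n]]%SET = fibers n (nseq n 0%N).
  rewrite fibers_const // => i; rewrite nth_nseq ltn_ord.
  by case: (n) n_gt0.
have nc_one : nc (nseq n 0%N).
  move=> a b /mem_subseq sub.
  have in0 c : c \in [:: a; b; a; b] -> c = 0%N.
    by move/sub; rewrite mem_nseq => /andP[_ /eqP].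
  have -> : a = 0%N by apply: in0; rewrite inE eqxx.
  by apply/esym/in0; rewrite !inE eqxx orbT.
have sz_one : size (nseq n 0%N) = n by rewrite size_nseq.
rewrite (big_pred1 [set [set: 'I_n]]%SET) => [|pi].
  by rewrite {}def_n in one_fib nc_one *; exact: (block_one hK).
apply/andP/eqP => [[piNC hb]|->].
  have part_pi : finset.partition pi [set: 'I_n]%SET.
    by move: piNC; rewrite inE => /andP[].
  rewrite -(fibers_block_labels part_pi) fibers_const // => i.
  move: hb => /andP[+ _]; rewrite take_oversize ?size_block_labels //.
  by move/allP/(_ (nth 0%N (block_labels pi) i))/(_ _)/eqP; apply;
     rewrite mem_nth ?size_block_labels.
rewrite one_fib; split; first exact/fibers_NC.
have [f f_inj ->] := block_labels_fibers sz_one.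
rewrite head_block_map // /head_block take0 andbT.
apply/allP => c /mem_take; rewrite mem_nseq => /andP[_ /eqP ->] /=.
by case: (n) n_gt0.
Qed.

Lemma blockD_sum (I : finType) (P : pred I) (F : I -> M) xi u w :
  \sum_(i | P i) K xi (u ++ F i :: w) = K xi (u ++ (\sum_(i | P i) F i) :: w).
Proof.
apply/esym/(big_morph (fun y => K xi (u ++ y :: w))) => [y z|].
  exact: blockD hK _ _ _ _ _.
by apply: (addrI (K xi (u ++ 0 :: w))); rewrite -(blockD hK) !addr0.
Qed.

Lemma vactDl_sum (I : finType) (P : pred I) (F : I -> M) v :
  \sum_(i | P i) vact (F i) v = vact (\sum_(i | P i) F i) v.
Proof.
apply/esym/(big_morph (fun b => vact b v)) => [y z|]; first exact: vactDl hK _ _ _.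
by apply: (addrI (vact 0 v)); rewrite -(vactDl hK) !addr0.
Qed.

Lemma vactDr_sum (I : finType) (P : pred I) (F : I -> V) b :
  \sum_(i | P i) vact b (F i) = vact b (\sum_(i | P i) F i).
Proof.
apply/esym/(big_morph (vact b)) => [y z|]; first exact: vactDr hK _ _ _.
by apply: (addrI (vact b 0)); rewrite -(vactDr hK) !addr0.
Qed.

(** Induction along the scan: the letters of [u] are in the first block together with [xi], [g] is
    the current gap, and [s] is still unread. The two branches of [gap_sum] are the two
    possibilities for the next letter. *)
Lemma head_block_sum (C : eqType) (s : seq (M * C)) n xi u g :
  n = ((size u).+1 + size g + size s)%N ->
  \sum_(pi in NC n | head_block (size u).+1 (size g) (block_labels pi))
     K_part pi xi (u ++ g ++ unzip1 s) =
  gap_sum E (fun t e => vact e (K xi (u ++ unzip1 t))) g s.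
Proof.
elim: s n xi u g => [|[a c] s IH] n xi u g def_n.
  (* The moment-cumulant formula covers nonempty words only; an empty gap contributes the factor
     [E 1 = 1]. *)
  have [g0|g0] := eqVneq g [::].
    rewrite g0 /= !cats0 big_nil (cexp1 hE) (vact1 hK) -(@sum_one_block n) //.
      by rewrite def_n g0 /= !addn0.
    by rewrite def_n g0 /= !addn0.
  rewrite /= def_n.
  have := sum_blocks xi u [::] g0; rewrite /= => sumE.
  rewrite (eq_bigl (fun pi => (pi \in NC ((size u).+1 + size g + 0)) &&
    (head_block (size u).+1 (size g) (block_labels pi) &&
      all (pred1 (head 0%N (block_labels pi)))
        (take 0 (drop ((size u).+1 + size g) (block_labels pi)))))); last first.
    by move=> pi; rewrite take0 andbT.
  rewrite sumE expectation_sum_cumulants // -vactDl_sum.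
  apply: eq_bigr => sigma sigNC; rewrite !cats0 !addn0.
  rewrite sum_one_block ?size_rmul_seq // (block_right hK) //.
  exact: kappa_part_NC_in.
(* Either the next letter belongs to the first block and closes the gap, or it extends the gap. The
   second case is the induction hypothesis for [rcons g a]. *)
rewrite (bigID (fun pi => nth 0%N (block_labels pi) ((size u).+1 + size g) ==
  head 0%N (block_labels pi))) /=; congr (_ + _); last first.
  rewrite -cat_rcons -(IH n) ?size_rcons; last by rewrite def_n /= addnS addnS.
  apply: eq_bigl => pi; rewrite -andbA -head_blockSr //.
  by rewrite size_block_labels def_n /= addnS ltnS leq_addr.
have [g0|g0] := eqVneq g [::].
  rewrite g0 /= big_nil (cexp1 hE) mul1r addn0.
  transitivity (gap_sum E (fun t e => vact e (K xi (rcons u a ++ unzip1 t))) [::] s).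
    rewrite -(IH n) ?size_rcons /= ?cat_rcons; last by rewrite def_n g0 /= !addnS !addn0.
    apply: eq_bigl => pi; rewrite -andbA -head_blockSl //.
    by rewrite size_block_labels def_n g0 /= addn0 addnS ltnS leq_addr.
  by apply: eq_gap_sum => t y; rewrite cat_rcons.
rewrite def_n; have := sum_blocks xi u (a :: unzip1 s) g0.
rewrite /= size_map => sumE.
rewrite (eq_bigl (fun pi => (pi \in NC ((size u).+1 + size g + (size s).+1)) &&
  (head_block (size u).+1 (size g) (block_labels pi) &&
   all (pred1 (head 0%N (block_labels pi)))
     (take 1 (drop ((size u).+1 + size g) (block_labels pi)))))); last first.
  move=> pi; rewrite -andbA; congr (_ && (_ && _)).
  rewrite (drop_nth 0%N) ?size_block_labels ?addnS ?ltnS ?leq_addr //.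
  by rewrite /= take0 andbT.
rewrite sumE.
(* The value on the gap was multiplied into the argument before it; balancedness moves it to the
   left of [a], where additivity sums it to [E] of the gap. *)
transitivity (\sum_(sigma in NC (size g)) gap_sum E (fun t e =>
    vact e (K xi (u ++ kappa_part sigma g * a :: unzip1 t))) [::] s).
  apply: eq_bigr => sigma sigNC.
  have bB := kappa_part_NC_in g0 sigNC; move: (kappa_part _ _) bB => b bB.
  transitivity (gap_sum E (fun t e => vact e (K (rmul_first ract u b xi)
      (rcons (rmul_seq u b) a ++ unzip1 t))) [::] s).
    rewrite -(IH ((size u).+1 + (size s).+1)%N).
      by rewrite size_rcons size_rmul_seq /= cat_rcons addn1.
    by rewrite size_rcons size_rmul_seq /= addn0 addnS.
  by apply: eq_gap_sum => t y; rewrite cat_rcons (block_balanced hK).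
rewrite gap_sum_sum expectation_sum_cumulants //.
apply: eq_gap_sum => t y; rewrite vactDr_sum; congr vact.
by rewrite mulr_suml -blockD_sum.
Qed.

Lemma block_recursion (C : eqType) (s : seq (M * C)) xi :
  \sum_(pi in NC (size s).+1) K_part pi xi (unzip1 s) =
  gap_sum E (fun t e => vact e (K xi (unzip1 t))) [::] s.
Proof.
rewrite -(@head_block_sum _ s (size s).+1 xi [::] [::]) //.
apply: eq_bigl => pi; rewrite -[LHS]andbT; congr (_ && _); apply/esym.
rewrite /head_block take0 andbT.
by case: (block_labels pi) => //= z l; rewrite eqxx take0.
Qed.

End GapRecursion.

(** * Cumulants of elements of M *)

Section SplitSum.
Variables (T : Type) (V : zmodType).

Fixpoint split_sum (F : seq T -> T -> seq T -> V) (s : seq T) : V :=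
  if s is x :: s' then F [::] x s' + split_sum (fun s1 => F (x :: s1)) s' else 0.

Lemma eq_split_sum (F G : seq T -> T -> seq T -> V) s :
  (forall s1 x s2, s = s1 ++ x :: s2 -> F s1 x s2 = G s1 x s2) ->
  split_sum F s = split_sum G s.
Proof.
elim: s F G => //= x s IH F G eqFG; congr (_ + _); first exact: eqFG.
by apply: IH => s1 y s2 def_s; apply: eqFG; rewrite def_s.
Qed.

Lemma split_sumD (F G : seq T -> T -> seq T -> V) s :
  split_sum (fun s1 x s2 => F s1 x s2 + G s1 x s2) s = split_sum F s + split_sum G s.
Proof.
elim: s F G => [|x s IH] F G /=; first by rewrite addr0.
by rewrite addrACA; congr (_ + _); apply: IH.
Qed.

Lemma split_sumN (F : seq T -> T -> seq T -> V) s :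
  split_sum (fun s1 x s2 => - F s1 x s2) s = - split_sum F s.
Proof.
elim: s F => [|x s IH] F /=; first by rewrite oppr0.
by rewrite opprD; congr (_ + _); apply: IH.
Qed.

Lemma split_sum_rcons (F : seq T -> T -> seq T -> V) s y :
  split_sum F (rcons s y) =
  split_sum (fun s1 x s2 => F s1 x (rcons s2 y)) s + F s y [::].
Proof.
elim: s F => [|x s IH] F /=; first by rewrite addrC.
by rewrite IH addrA.
Qed.

(** Both sides sum [D] over all cuts of [s] into two words; the left one splits off the cut at the
    end, the right one the cut at the beginning. *)
Lemma split_sum_telescope (D : seq T -> seq T -> V) s :
  split_sum (fun s1 x s2 => D s1 (x :: s2)) s + D s [::] =
  D [::] s + split_sum (fun s1 x s2 => D (rcons s1 x) s2) s.
Proof.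
elim: s D => [|x s IH] D /=; first by rewrite add0r addr0.
by rewrite -addrA (IH (fun s1 => D (x :: s1))).
Qed.

End SplitSum.

Lemma split_sum_morph (T : Type) (V W : zmodType) (f : {additive V -> W})
    (F : seq T -> T -> seq T -> V) s :
  f (split_sum F s) = split_sum (fun s1 x s2 => f (F s1 x s2)) s.
Proof. by elim: s F => [|x s IH] F /=; rewrite ?raddf0 // raddfD IH. Qed.

(** * Grouping subwords by their first or last letter, and triangularity *)

Section GapSumTheory.
Variables (R : realType) (M : vNalgebra R) (E : {linear M -> M}).
Variable C : eqType.
Implicit Types (s t : seq (M * C)) (g : seq M).

Lemma gap_sum_first (V : zmodType) (K : seq (M * C) -> M -> V) g s :
  gap_sum E K g s = K [::] (E (\prod_(x <- g ++ unzip1 s) x)) +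
    split_sum (fun s1 x s2 => gap_sum E (fun t e =>
      K ((E (\prod_(y <- g ++ unzip1 s1) y) * x.1, x.2) :: t) e) [::] s2) s.
Proof.
elim: s g => [|[a c] s IH] g /=; first by rewrite cats0 addr0.
rewrite IH cats0 cat_rcons addrCA; congr (_ + (_ + _)).
by apply: eq_split_sum => s1 x s2 _; rewrite cat_rcons.
Qed.

(** For the subword without its last letter, that letter's gap is the end gap, whose expectation is
    [e]; hence the factor [e * x.1]. *)
Lemma gap_sum_last (V : zmodType) (K : seq (M * C) -> M -> V) g s :
  gap_sum E K g s = K [::] (E (\prod_(x <- g ++ unzip1 s) x)) +
    split_sum (fun s1 x s2 => gap_sum E (fun t e =>
      K (rcons t (e * x.1, x.2)) (E (\prod_(y <- unzip1 s2) y))) g s1) s.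
Proof.
elim: s K g => [|[a c] s IH] K g /=; first by rewrite cats0 addr0.
by rewrite !IH cat_rcons split_sumD addrCA -!addrA.
Qed.

Lemma gap_sumD (V : zmodType) (K K' : seq (M * C) -> M -> V) g s :
  gap_sum E (fun t e => K t e + K' t e) g s = gap_sum E K g s + gap_sum E K' g s.
Proof. by elim: s K K' g => [|[a c] s IH] K K' g //=; rewrite !IH addrACA. Qed.

Lemma gap_sum_morph (V W : zmodType) (f : V -> W)
    (K : seq (M * C) -> M -> V) g s : {morph f : v w / v + w} ->
  gap_sum E (fun t e => f (K t e)) g s = f (gap_sum E K g s).
Proof. by move=> fD; elim: s K g => [|[a c] s IH] K g //=; rewrite !IH fD. Qed.

Lemma gap_sum0 (V : zmodType) g s : gap_sum E (fun _ _ => 0 : V) g s = 0.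
Proof. by elim: s g => [|[a c] s IH] g //=; rewrite !IH addr0. Qed.

(** Triangularity: the only subword as long as [s] is [s] itself, without gaps, and on all shorter
    ones the kernels agree. This lets recursions for moments be inverted by induction on the
    length. *)
Lemma gap_sum_diff (V : zmodType) (P : M * C -> Prop) (B : set M)
    (K K' : seq (M * C) -> M -> V) s :
    E 1 = 1 -> (forall y, B (E y)) -> (forall a c y, P (a, c) -> P (E y * a, c)) ->
    (forall x, x \in s -> P x) ->
    (forall t e, (size t < size s)%N ->
      (forall x, x \in t -> P x) -> B e -> K t e = K' t e) ->
  gap_sum E K [::] s - gap_sum E K' [::] s = K s 1 - K' s 1.
Proof.
move=> E1 BE PE; elim: s K K' => [|[a c] s IH] K K' Ps eqK /=; first by rewrite big_nil E1.
have Pac : P (a, c) by apply: Ps; rewrite mem_head.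
have Ps' x : x \in s -> P x by move=> xs; apply: Ps; rewrite in_cons xs orbT.
rewrite big_nil E1 mul1r (@eq_gap_sum_in _ _ _ _ _ P B K K' [:: a]) //.
rewrite opprD addrACA subrr addr0; apply: IH => // t e lt_t Pt Be; apply: eqK => //.
by move=> x; rewrite in_cons => /predU1P[->|/Pt].
Qed.

End GapSumTheory.

(** * Moment formulas for the first and the last argument, and cumulants with an end in [B] *)

Section ScalarCumulants.
Variables (R : realType) (M : vNalgebra R) (B : set M) (E : {linear M -> M}).
Hypothesis hE : conditional_expectation B E.
Variables (kappa : seq M -> M) (kappa_part : forall n, {set {set 'I_n}} -> seq M -> M).
Hypothesis hkappa : cumulants B E kappa kappa_part.

Lemma cumulants_block : block_cumulants B kappa (fun b x => x * b) (fun b x => x * b)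
  (fun x s => kappa (x :: s)) (fun n pi x s => kappa_part pi (x :: s)).
Proof.
split.
- exact: mulr1.
- by move=> a b v; rewrite mulrDr.
- by move=> b v w; rewrite mulrDl.
- by move=> xi u x y w; have := kappa_linear hkappa (xi :: u) 1 x y w; rewrite !scale1r.
- move=> b xi u y w Bb; case/lastP: u => [|u x].
    exact: (kappa_balanced hkappa [::]).
  rewrite rmul_seq_rcons cat_rcons cat_rcons; case: u => [|z u] /=.
    exact: (kappa_balanced hkappa [:: xi]).
  exact: (kappa_balanced hkappa (xi :: z :: u)).
- move=> b xi u Bb; case/lastP: u => [|u x].
    exact: (kappa_right hkappa [::]).
  rewrite rmul_seq_rcons; case: u => [|z u] /=.
    exact: (kappa_right hkappa [:: xi]).
  exact: (kappa_right hkappa (xi :: z :: u)).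
- by move=> xi s; apply: (@kappa_one_block _ _ _ _ _ _ hkappa (xi :: s)).
- move=> xi u v w; case/lastP: u => [|u x].
    exact: (kappa_inner_block hkappa (u := [::])).
  rewrite rmul_seq_rcons size_rcons => pi piNC v0 pi_in.
  have := kappa_inner_block hkappa (u := xi :: u) x piNC v0 pi_in.
  by case: u pi piNC pi_in.
Qed.

Lemma moment_recursion (C : eqType) a (s : seq (M * C)) :
  E (a * \prod_(x <- unzip1 s) x) =
  gap_sum E (fun t e => kappa (a :: unzip1 t) * e) [::] s.
Proof.
rewrite -(block_recursion hE hkappa cumulants_block).
have -> : a * \prod_(x <- unzip1 s) x = \prod_(x <- a :: unzip1 s) x.
  by rewrite big_cons.
by rewrite (moment_cumulant hkappa) //= size_map.
Qed.

Lemma expectation_Bl b x : B b -> E (b * x) = b * E x.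
Proof.
move=> Bb; have B1 : B 1 by rewrite -(cexp1 hE); apply: cexp_in hE _.
by have := cexp_bimod hE x Bb B1; rewrite !mulr1.
Qed.

Lemma expectation_id b : B b -> E b = b.
Proof. by move=> Bb; rewrite -[in LHS](mulr1 b) expectation_Bl // (cexp1 hE) mulr1. Qed.

Lemma kappa1 a : kappa [:: a] = E a.
Proof.
have := moment_recursion a ([::] : seq (M * unit)).
by rewrite /= !big_nil (cexp1 hE) !mulr1.
Qed.

Lemma moment_recursion_last (C : eqType) (s : seq (M * C)) a :
  gap_sum E (fun t e => kappa (rcons (unzip1 t) (e * a))) [::] s =
  E (\prod_(x <- rcons (unzip1 s) a) x).
Proof.
have [n] := ubnP (size s); elim: n s a => // n IH s a; rewrite ltnS => le_s.
(* The letter [a] needs a tag before it can be appended to [s]. A nonempty [s] supplies one, and the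
   empty word is treated directly. *)
have [->|[c0 _]] : s = [::] \/ exists c : C, True.
- by case: (s) => [|[b c] s']; [left | right; exists c].
- by rewrite /= !big_nil (cexp1 hE) mul1r kappa1 big_seq1.
pose z : M * C := (a, c0); pose s' := rcons s z.
pose D (s1 s2 : seq (M * C)) : M :=
  E (\prod_(x <- unzip1 s1) x) * E (\prod_(x <- unzip1 s2) x).
(* The kernel vanishes on the empty subword. Grouping the rest by the first letter gives products of
   two moments; grouping it by the last letter gives the sums under study. *)
pose K (t : seq (M * C)) (e : M) : M := if nilp t then 0 else kappa (unzip1 t) * e.
have firstE : gap_sum E K [::] s' = split_sum (fun s1 x s2 => D s1 (x :: s2)) s'.
  rewrite gap_sum_first add0r; apply: eq_split_sum => s1 x s2 _.
  rewrite -moment_recursion -mulrA expectation_Bl /D /= ?big_cons //.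
  exact: cexp_in hE _.
have lastE : gap_sum E K [::] s' = split_sum (fun s1 x s2 =>
    gap_sum E (fun t e => kappa (rcons (unzip1 t) (e * x.1))) [::] s1 *
    E (\prod_(y <- unzip1 s2) y)) s'.
  rewrite gap_sum_last add0r; apply: eq_split_sum => s1 x s2 _.
  rewrite -(gap_sum_morph _ _ _ (f := fun v => v * _)) => [|v w]; last exact: mulrDl.
  apply: eq_gap_sum => t y.
  by rewrite /K /nilp size_rcons /= /unzip1 map_rcons.
(* Telescoping moves the marked letter from the right factor of [D] to the left one. By induction
   the terms marked before the last position agree, and the term marked at [z] is the claim. *)
have := split_sum_telescope D s'; rewrite -firstE lastE.
have -> : D s' [::] = D [::] s' by rewrite /D /= big_nil (cexp1 hE) mulr1 mul1r.
rewrite addrC => /addrI.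
rewrite !split_sum_rcons /D /= !big_nil !(cexp1 hE) !mulr1.
set S1 := split_sum _ s; set S2 := split_sum _ s.
have -> : S1 = S2.
  apply: eq_split_sum => s1 x s2 def_s.
  rewrite IH /unzip1 ?map_rcons //.
  by move: le_s; rewrite def_s size_cat /= addnS; apply: leq_trans; rewrite ltnS leq_addr.
by move/addrI => ->; rewrite /unzip1 map_rcons.
Qed.

Lemma gap_sum_empty (C : eqType) g (s : seq (M * C)) :
  gap_sum E (fun t e => if nilp t then e else 0) g s = E (\prod_(x <- g ++ unzip1 s) x).
Proof.
elim: s g => [|[a c] s IH] g /=; first by rewrite cats0.
by rewrite gap_sum0 add0r IH cat_rcons.
Qed.

Lemma unzip1_tt (t : seq M) : unzip1 [seq (x, tt) | x <- t] = t.
Proof. by rewrite /unzip1 -map_comp map_id. Qed.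

(** In the expansion of [E (1 * t)] the empty subword alone already gives [E] of the product. The
    shorter nonempty subwords vanish by induction, so the full one must vanish too. *)
Lemma kappa_1l t : t != [::] -> kappa (1 :: t) = 0.
Proof.
have [n] := ubnP (size t); elim: n t => // n IH t; rewrite ltnS => le_t t0.
pose s := [seq (x, tt) | x <- t].
pose K (t : seq (M * unit)) (e : M) := kappa (1 :: unzip1 t) * e.
pose K' (t : seq (M * unit)) (e : M) := if nilp t then e else 0.
have := @gap_sum_diff _ _ E unit M (fun=> True) B K K' s (cexp1 hE) (cexp_in hE).
rewrite -moment_recursion gap_sum_empty /= mul1r subrr /K /K' unzip1_tt mulr1.
rewrite /s /nilp size_map size_eq0 (negPf t0) subr0 => <- // r e.
move=> lt_r _ Be; case: eqP => [/size0nil ->|/eqP r0].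
  by rewrite kappa1 (cexp1 hE) mul1r.
rewrite IH ?mul0r ?size_map ?(leq_trans lt_r) //.
by rewrite -size_eq0 size_map.
Qed.

Lemma kappa_Bl b t : B b -> t != [::] -> kappa (b :: t) = 0.
Proof. by move=> Bb t0; rewrite -(mulr1 b) (kappa_left hkappa) // kappa_1l ?mulr0. Qed.

(** As for [kappa_1l], with the recursion for the last argument; the end gap [e] lies in [B] and
    comes out on the right. *)
Lemma kappa_1r t : t != [::] -> kappa (rcons t 1) = 0.
Proof.
have [n] := ubnP (size t); elim: n t => // n IH t; rewrite ltnS => le_t t0.
pose s := [seq (x, tt) | x <- t].
pose K (t : seq (M * unit)) (e : M) := kappa (rcons (unzip1 t) (e * 1)).
pose K' (t : seq (M * unit)) (e : M) := if nilp t then e else 0.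
have := @gap_sum_diff _ _ E unit M (fun=> True) B K K' s (cexp1 hE) (cexp_in hE).
rewrite moment_recursion_last gap_sum_empty /= -cats1 big_cat big_seq1 /= mulr1 subrr.
rewrite /K /K' unzip1_tt mulr1 /s /nilp size_map size_eq0 (negPf t0) subr0 => <- // r e.
move=> lt_r _ Be; rewrite mulr1; case: eqP => [/size0nil ->|/eqP r0].
  by rewrite kappa1 expectation_id.
rewrite -(mul1r e) (kappa_right hkappa) // IH ?mul0r ?size_map ?(leq_trans lt_r) //.
by rewrite -size_eq0 size_map.
Qed.

Lemma kappa_Br b t : B b -> t != [::] -> kappa (rcons t b) = 0.
Proof. by move=> Bb t0; rewrite -(mul1r b) (kappa_right hkappa) // kappa_1r ?mul0r. Qed.

(* The tag true stands for A1 and false for A2: the sign in the cumulant system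
   is [last letter in A1] - [first letter in A1]. *)
Definition boundary_cumulant (t : seq (M * bool)) : M :=
  (if last false (unzip2 t) then kappa (unzip1 t) else 0) -
  (if head false (unzip2 t) then kappa (unzip1 t) else 0).

Lemma gap_sum_boundary (s : seq (M * bool)) :
  gap_sum E (fun t e => boundary_cumulant t * e) [::] s =
  split_sum (fun s1 x s2 => if x.2 then
    E (\prod_(y <- rcons (unzip1 s1) x.1) y) * E (\prod_(y <- unzip1 s2) y) -
    E (\prod_(y <- unzip1 s1) y) * E (x.1 * \prod_(y <- unzip1 s2) y) else 0) s.
Proof.
rewrite (@eq_gap_sum _ _ _ _ _ _ (fun t e =>
  (if last false (unzip2 t) then kappa (unzip1 t) * e else 0) +
  - (if head false (unzip2 t) then kappa (unzip1 t) * e else 0))); last first.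
  move=> t y; rewrite /boundary_cumulant mulrBl.
  by congr (_ - _); case: ifP => // _; rewrite mul0r.
(* The term governed by the last tag is grouped by the last letter, the one governed by the first
   tag by the first letter. *)
rewrite gap_sumD (gap_sum_morph _ _ _ _ (@opprD M)) gap_sum_last gap_sum_first /= !add0r.
rewrite -split_sumN -split_sumD; apply: eq_split_sum => s1 [a []] s2 _ /=.
  congr (_ - _).
    rewrite -moment_recursion_last -(gap_sum_morph _ _ _ (f := fun v => v * _)); last first.
      by move=> v w; apply: mulrDl.
    by apply: eq_gap_sum => t y; rewrite /unzip1 /unzip2 !map_rcons last_rcons.
  by rewrite -moment_recursion -mulrA expectation_Bl //; apply: cexp_in hE _.
rewrite gap_sum0 subr0 -[RHS](gap_sum0 E M [::] s1).
by apply: eq_gap_sum => t y; rewrite /unzip2 map_rcons last_rcons.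
Qed.

End ScalarCumulants.

(** * L^2 and the liberation derivation *)

Section L2Extension.
Variables (R : realType) (M : vNalgebra R) (tau : {scalar M}) (L2 : L2_space tau).
Local Notation inj := (L2_inj L2).

(** The set where [F] and [G] differ is open, so if nonempty it would meet the dense image of
    [M]. *)
Lemma L2_eq_continuous (F G : L2 -> L2) : continuous F -> continuous G ->
  (forall x, F (inj x) = G (inj x)) -> forall xi, F xi = G xi.
Proof.
move=> Fc Gc eqFG xi; apply: contrapT => neqFG.
have Hc : continuous (fun eta => F eta - G eta).
  by move=> eta; apply: continuousB; [apply: Fc | apply: Gc].
have U_open : open [set eta | F eta - G eta != 0].
  have -> : [set eta | F eta - G eta != 0] =
      (fun eta => F eta - G eta) @^-1` (~` [set 0]).
    by apply/seteqP; split=> eta /= /eqP.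
  apply: open_comp => [eta _|]; first exact: Hc.
  apply: closed_openC; apply: accessible_closed_set1.
  exact/hausdorff_accessible/norm_hausdorff.
have [||eta [Ueta [x _ xeta]]] := @L2_dense _ _ _ L2 [set eta | F eta - G eta != 0].
- by exists xi; rewrite /= subr_eq0; apply/eqP.
- exact: U_open.
- by move: Ueta; rewrite /= -xeta eqFG subrr eqxx.
Qed.

(** [L2_ract] is linear in the vector by its type. Linearity in the multiplier holds on the image of
    [M] and extends by density. *)
Lemma L2_ract_linear c x y xi :
  L2_ract L2 (c *: x + y) xi = c *: L2_ract L2 x xi + L2_ract L2 y xi.
Proof.
apply: (@L2_eq_continuous (L2_ract L2 (c *: x + y))
  (fun xi => c *: L2_ract L2 x xi + L2_ract L2 y xi)) xi => [|xi|z].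
- exact: L2_ract_continuous.
- by apply: cvgD; [apply: cvgZ; [exact: cvg_cst|]|]; exact: L2_ract_continuous.
- by rewrite !L2_ractE mulrDr -scalerAr linearP.
Qed.

Lemma L2_ract1 xi : L2_ract L2 1 xi = xi.
Proof.
apply: (@L2_eq_continuous (L2_ract L2 1) id) xi => [|xi|z].
- exact: L2_ract_continuous.
- exact: cvg_id.
- by rewrite L2_ractE mulr1.
Qed.

Lemma L2_extension_linear (E : {linear M -> M}) (E2 : L2 -> L2) :
  is_L2_extension E E2 -> linear E2.
Proof.
move=> [E2c E2E] c xi eta.
apply: (@L2_eq_continuous (fun eta => E2 (c *: xi + eta))
  (fun eta => c *: E2 xi + E2 eta)) eta => [eta|eta|y].
- apply: (@continuous_comp _ _ _ (fun eta => c *: xi + eta) E2); last exact: E2c.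
  by apply: cvgD; [exact: cvg_cst | exact: cvg_id].
- by apply: cvgD; [exact: cvg_cst | exact: E2c].
(* Density is used a second time, now in the variable [xi]. *)
- apply: (@L2_eq_continuous (fun xi => E2 (c *: xi + inj y))
    (fun xi => c *: E2 xi + E2 (inj y))) xi => [xi|xi|x].
  + apply: (@continuous_comp _ _ _ (fun xi => c *: xi + inj y) E2); last exact: E2c.
    by apply: cvgD; [apply: cvgZ; [exact: cvg_cst | exact: cvg_id] | exact: cvg_cst].
  + by apply: cvgD; [apply: cvgZ; [exact: cvg_cst | exact: E2c] | exact: cvg_cst].
  + by rewrite -linearP !E2E !linearP.
Qed.

End L2Extension.

Section L2Recursion.
Variables (R : realType) (M : vNalgebra R) (tau : {scalar M}) (L2 : L2_space tau).
Variables (B : set M) (E : {linear M -> M}).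
Hypothesis hE : conditional_expectation B E.
Variables (kappa : seq M -> M) (kappa_part : forall n, {set {set 'I_n}} -> seq M -> M).
Hypothesis hkappa : cumulants B E kappa kappa_part.
Variables (E2 : L2 -> L2) (kappa2 : L2 -> seq M -> L2).
Variable kappa2_part : forall n, {set {set 'I_n}} -> L2 -> seq M -> L2.
Hypothesis hkappa2 : L2_cumulants B E2 kappa kappa2 kappa2_part.

Lemma L2_cumulants_block :
  block_cumulants B kappa (fun b xi => L2_ract L2 b xi) (fun b xi => L2_ract L2 b xi)
    kappa2 kappa2_part.
Proof.
split.
- exact: L2_ract1.
- by move=> a b v; have := L2_ract_linear 1 a b v; rewrite !scale1r.
- by move=> b v w; rewrite linearD.
- by move=> xi u x y w; have := kappa2_linear hkappa2 xi u 1 x y w; rewrite !scale1r.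
- move=> b xi u y w Bb; case/lastP: u => [|u x]; first exact: (kappa2_balanced1 hkappa2).
  rewrite rmul_seq_rcons !cat_rcons -(kappa2_balanced hkappa2) //.
  by case: u.
- move=> b xi u Bb; case/lastP: u => [|u x]; first exact: (kappa2_right1 hkappa2).
  by rewrite rmul_seq_rcons -(kappa2_right hkappa2) //; case: u.
- exact: (kappa2_one_block hkappa2).
- move=> xi u v w; case/lastP: u => [|u x].
    exact: (kappa2_second_block hkappa2).
  rewrite rmul_seq_rcons size_rcons => pi piNC v0 pi_in.
  have := kappa2_inner_block hkappa2 xi x piNC v0 pi_in.
  by case: u pi piNC pi_in.
Qed.

Lemma moment_recursion2 (C : eqType) xi (s : seq (M * C)) :
  E2 (L2_ract L2 (\prod_(x <- unzip1 s) x) xi) =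
  gap_sum E (fun t e => L2_ract L2 e (kappa2 xi (unzip1 t))) [::] s.
Proof.
rewrite -(block_recursion hE hkappa L2_cumulants_block).
by rewrite (moment_cumulant2 hkappa2) size_map.
Qed.

End L2Recursion.

(** * Words span the algebra generated by [A1] and [A2] *)

Section Join.
Variables (R : realType) (M : vNalgebra R) (A1 A2 : set M).
Local Notation A := (alg_join A1 A2).

Lemma alg_join_subalgebra : subalgebra A.
Proof.
split=> [N [] //|c x y Ax Ay N subN sN|x y Ax Ay N subN sN];
  case: (subN) => _ NL NM; [apply: NL | apply: NM]; by [apply: Ax | apply: Ay].
Qed.

Lemma alg_joinM x y : A x -> A y -> A (x * y).
Proof. by case: alg_join_subalgebra => _ _; apply. Qed.

Lemma sub_alg_join x : A1 x \/ A2 x -> A x.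
Proof. by move=> Ax N _ sN; apply: sN. Qed.

Lemma alg_join_prod (s : seq M) : (forall x, x \in s -> A1 x \/ A2 x) ->
  A (\prod_(x <- s) x).
Proof.
elim: s => [|x s IH] As; first by rewrite big_nil; case: alg_join_subalgebra.
rewrite big_cons; apply: alg_joinM.
  by apply: sub_alg_join; apply: As; rewrite mem_head.
by apply: IH => y ys; apply: As; rewrite in_cons ys orbT.
Qed.

(** The linear span of the words is a subalgebra containing [A1] and [A2], hence contains the join,
    which is an intersection of subalgebras. *)
Lemma alg_join_ind (Q : M -> Prop) :
  (forall s : seq M, (forall x, x \in s -> A1 x \/ A2 x) -> Q (\prod_(x <- s) x)) ->
  (forall c x y, A x -> A y -> Q x -> Q y -> Q (c *: x + y)) ->
  forall x, A x -> Q x.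
Proof.
move=> Qprod Qlin x Ax.
pose word (s : seq M) := forall x, x \in s -> A1 x \/ A2 x.
pose span : set M := [set x | forall P : M -> Prop,
  (forall s, word s -> P (\prod_(x <- s) x)) ->
  (forall c x y, P x -> P y -> P (c *: x + y)) -> P x].
have span_word s : word s -> span (\prod_(x <- s) x) by move=> ws P Pw _; apply: Pw.
have span_lin c y z : span y -> span z -> span (c *: y + z).
  by move=> sy sz P Pw Pl; exact: (Pl c y z (sy P Pw Pl) (sz P Pw Pl)).
have span_sub : subalgebra span.
  split=> //; first by rewrite -[1](big_nil _ *%R predT id); apply: span_word.
  move=> y z sy sz; apply: (sy (fun y => span (y * z))) => [s ws|c y1 y2 H1 H2].
    apply: (sz (fun z => span (_ * z))) => [s' ws'|c z1 z2 H1 H2].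
      rewrite -big_cat; apply: span_word => t.
      by rewrite mem_cat => /orP[/ws|/ws'].
    by rewrite mulrDr -scalerAr; apply: span_lin.
  by rewrite mulrDl -scalerAl; apply: span_lin.
have sx : span x.
  apply: Ax => // y Ay; rewrite -[y](big_seq1 *%R _ id); apply: span_word => t.
  by rewrite inE => /eqP ->.
(* Membership in the join is carried along, because the linear step for [Q] requires it. *)
have [] // : A x /\ Q x.
apply: (sx (fun x => A x /\ Q x)) => [s ws|c y z [Ay Qy] [Az Qz]].
  by split; [apply: alg_join_prod | apply: Qprod].
by split; [case: alg_join_subalgebra => _ + _; apply | apply: Qlin].
Qed.

End Join.

(** * The derivation and the cumulant system on tagged words *)

Section Liberation.
Variables (R : realType) (M : vNalgebra R) (B : set M) (E : {linear M -> M}).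
Hypothesis hE : conditional_expectation B E.
Variables A1 A2 : set M.
Hypotheses (hA1 : subalgebra A1) (hA2 : subalgebra A2).
Local Notation A := (alg_join A1 A2).
Variables (T : balanced_tensor B A) (delta : M -> T).
Hypothesis hdelta : liberation_derivation delta.

(** A letter in both algebras may carry either tag; [liberation_boundary] holds for every choice. *)
Definition tagged_letter (x : M * bool) : Prop := if x.2 then A1 x.1 else A2 x.1.

Lemma tagged_letterW x : tagged_letter x -> A1 x.1 \/ A2 x.1.
Proof. by case: x => a [] ?; [left | right]. Qed.

Lemma tagged_prod (s : seq (M * bool)) : (forall x, x \in s -> tagged_letter x) ->
  A (\prod_(x <- unzip1 s) x).
Proof.
by move=> Ps; apply: alg_join_prod => x /mapP[y /Ps/tagged_letterW ? ->].
Qed.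

(* The derivation gives a (x) 1 = 1 (x) a for a in both A1 and A2, which
   E (x) id maps to E a = a. *)
Lemma liberation_inter a : A1 a -> A2 a -> B a.
Proof.
move=> A1a A2a.
have bal : balanced_bilinear_on B A (fun x y => E x * y : M).
  split=> [c x x' y _ _ _|c x y y' _ _ _|x b y _ Bb _].
  - by rewrite linearP mulrDl scalerAl.
  - by rewrite mulrDr scalerAr.
  - have B1 : B 1 by rewrite -(cexp1 hE); apply: cexp_in hE _.
    by have := cexp_bimod hE x B1 Bb; rewrite !mul1r => ->; rewrite mulrA.
have [_ [[g [-> gE]] _]] := tens_universal T bal.
have A1' : A 1 by case: (alg_join_subalgebra A1 A2).
have Aa : A a by apply: sub_alg_join; left.
have := delta1 hdelta A1a; rewrite (delta2 hdelta A2a).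
move=> /(congr1 g); rewrite linear0 linearB !gE // mulr1 (cexp1 hE) mul1r.
by move/esym/subr0_eq <-; apply: cexp_in hE _.
Qed.

(** The Leibniz rule, with the letters of [A2] annihilated. The empty word is [1], which lies in
    [A2]. *)
Lemma delta_prod (s : seq (M * bool)) : (forall x, x \in s -> tagged_letter x) ->
  delta (\prod_(x <- unzip1 s) x) =
  split_sum (fun s1 x s2 => if x.2 then
    tens T (\prod_(y <- rcons (unzip1 s1) x.1) y) (\prod_(y <- unzip1 s2) y) -
    tens T (\prod_(y <- unzip1 s1) y) (x.1 * \prod_(y <- unzip1 s2) y) else 0) s.
Proof.
elim: s => [|[a c] s IH] Ps /=.
  by rewrite big_nil (delta2 hdelta) //; case: hA2.
have Pac : tagged_letter (a, c) by apply: Ps; rewrite mem_head.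
have Ps' x : x \in s -> tagged_letter x by move=> xs; apply: Ps; rewrite in_cons xs orbT.
have As := tagged_prod Ps'; have Aa : A a := sub_alg_join (tagged_letterW Pac).
have A1' : A 1 by case: (alg_join_subalgebra A1 A2).
rewrite big_cons (deltaM hdelta) // IH //; congr (_ + _).
  case: c Pac {Ps} => /= [A1a|A2a]; last by rewrite (delta2 hdelta) // linear0.
  by rewrite (delta1 hdelta) // linearB !tens_ractE // mul1r big_seq1 big_nil.
rewrite split_sum_morph; apply: eq_split_sum => s1 [b []] s2 def_s /=; last first.
  by rewrite linear0.
have [Pb P1 P2] : [/\ tagged_letter (b, true), forall x, x \in s1 -> tagged_letter x
    & forall x, x \in s2 -> tagged_letter x].
  by split=> [|x xs|x xs]; apply: Ps'; rewrite def_s mem_cat in_cons ?eqxx ?xs ?orbT.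
have Ab : A b := sub_alg_join (tagged_letterW Pb).
have [As1 As2] := (tagged_prod P1, tagged_prod P2).
rewrite linearB !tens_lactE ?big_cons //; first exact: alg_joinM.
by rewrite -cats1 big_cat big_seq1; apply: alg_joinM.
Qed.

Lemma tensor_delta_prod (EE : {linear T -> M}) (s : seq (M * bool)) :
  is_tensor_square E EE -> (forall x, x \in s -> tagged_letter x) ->
  EE (delta (\prod_(x <- unzip1 s) x)) =
  split_sum (fun s1 x s2 => if x.2 then
    E (\prod_(y <- rcons (unzip1 s1) x.1) y) * E (\prod_(y <- unzip1 s2) y) -
    E (\prod_(y <- unzip1 s1) y) * E (x.1 * \prod_(y <- unzip1 s2) y) else 0) s.
Proof.
move=> hEE Ps; rewrite delta_prod // split_sum_morph.
apply: eq_split_sum => s1 [b []] s2 def_s /=; last exact: linear0.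
have [Pb P1 P2] : [/\ tagged_letter (b, true), forall x, x \in s1 -> tagged_letter x
    & forall x, x \in s2 -> tagged_letter x].
  by split=> [|x xs|x xs]; apply: Ps; rewrite def_s mem_cat in_cons ?eqxx ?xs ?orbT.
have Ab : A b := sub_alg_join (tagged_letterW Pb).
have [As1 As2] := (tagged_prod P1, tagged_prod P2).
rewrite linearB !hEE //; first exact: alg_joinM.
by rewrite -cats1 big_cat big_seq1; apply: alg_joinM.
Qed.

Variables (kappa : seq M -> M) (kappa_part : forall n, {set {set 'I_n}} -> seq M -> M).
Hypothesis hkappa : cumulants B E kappa kappa_part.

(** Tags and the case distinction can disagree only if an end letter lies in both algebras. It is
    then in [B], and a cumulant of length at least two with an end in [B] is 0. For a single letter
    both sides are 0. *)
Lemma liberation_boundary x (t : seq (M * bool)) :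
  (forall y, y \in x :: t -> tagged_letter y) ->
  liberation_cumulant kappa A1 A2 x.1 (unzip1 t) = boundary_cumulant kappa (x :: t).
Proof.
move=> Pt; rewrite /liberation_cumulant /boundary_cumulant /=.
have Px : tagged_letter x by apply: Pt; rewrite mem_head.
have Pz : tagged_letter (last x t) by apply: Pt; rewrite mem_last.
rewrite /unzip1 /unzip2 !last_map.
have [t0|t_n0] := eqVneq t [::].
  rewrite t0 /= subrr; case: asboolP => // -[].
  by case: x Px {Pt Pz} => a [] ?; [left | right].
have k0 : B x.1 -> kappa (x.1 :: map fst t) = 0.
  move=> Bx; apply: (kappa_Bl hE hkappa Bx).
  by rewrite -size_eq0 size_map size_eq0.
have kz : B (last x t).1 -> kappa (x.1 :: map fst t) = 0.
  case/lastP: t t_n0 {Pt Pz k0} => // t z _; rewrite last_rcons map_rcons => Bz.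
  exact: (kappa_Br hE hkappa (t := x.1 :: map fst t) Bz).
move: Px Pz; rewrite /tagged_letter; case: x.2; case: (last x t).2 => Px Pz.
- by rewrite asboolT ?subrr //; left.
- rewrite sub0r; case: asboolP => [[[_ A1z]|[A2x _]]|_].
  + by rewrite kz ?oppr0 //; apply: liberation_inter.
  + by rewrite k0 ?oppr0 //; apply: liberation_inter.
  + by rewrite asboolT.
- rewrite subr0; case: asboolP => [[[A1x _]|[_ A2z]]|not_same].
  + by rewrite k0 //; apply: liberation_inter.
  + by rewrite kz //; apply: liberation_inter.
  + case: asboolP => [[A1x _]|_]; first by case: not_same; left.
    by rewrite asboolT.
- by rewrite asboolT ?subrr //; right.
Qed.

End Liberation.

(** * The two systems of equations on tagged words *)

Section GradientWords.
Variables (R : realType) (M : vNalgebra R) (tau : {scalar M}) (L2 : L2_space tau).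
Variables (B : set M) (E : {linear M -> M}).
Hypothesis hE : conditional_expectation B E.
Variables A1 A2 : set M.
Hypotheses (hA1 : subalgebra A1) (hA2 : subalgebra A2).
Hypotheses (hBA1 : B `<=` A1) (hBA2 : B `<=` A2).
Variables (T : balanced_tensor B (alg_join A1 A2)) (delta : M -> T).
Hypothesis hdelta : liberation_derivation delta.
Variable EE : {linear T -> M}.
Hypothesis hEE : is_tensor_square E EE.
Variables (kappa : seq M -> M) (kappa_part : forall n, {set {set 'I_n}} -> seq M -> M).
Hypothesis hkappa : cumulants B E kappa kappa_part.
Variables (E2 : L2 -> L2) (kappa2 : L2 -> seq M -> L2).
Variable kappa2_part : forall n, {set {set 'I_n}} -> L2 -> seq M -> L2.
Hypothesis hkappa2 : L2_cumulants B E2 kappa kappa2 kappa2_part.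
Variable j : L2.
Local Notation letter := (tagged_letter A1 A2).

Lemma tagged_letter_Bl a c y : letter (a, c) -> letter (E y * a, c).
Proof.
have [_ _ A1M] := hA1; have [_ _ A2M] := hA2; have By := cexp_in hE y.
by case: c => /= ?; [apply: A1M => //; apply: hBA1 | apply: A2M => //; apply: hBA2].
Qed.

Lemma gradient_word (s : seq (M * bool)) : (forall x, x \in s -> letter x) ->
  L2_inj L2 (EE (delta (\prod_(x <- unzip1 s) x))) =
  gap_sum E (fun t e => L2_ract L2 e (L2_inj L2 (boundary_cumulant kappa t))) [::] s.
Proof.
move=> Ps; rewrite (tensor_delta_prod hA2 hdelta hEE Ps).
rewrite -(gap_sum_boundary hE hkappa) -(gap_sum_morph _ _ _ _ (linearD _)).
by apply: eq_gap_sum => t y; rewrite L2_ractE.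
Qed.

(** Both moments are gap sums, with kernels built from [kappa2 j] and from [boundary_cumulant].
    Equal kernels give equal sums; conversely [gap_sum_diff] isolates the kernels at the full word,
    by induction on its length. *)
Lemma cumulants_of_words :
  (forall s : seq (M * bool), (forall x, x \in s -> letter x) ->
    E2 (L2_ract L2 (\prod_(x <- unzip1 s) x) j) =
    L2_inj L2 (EE (delta (\prod_(x <- unzip1 s) x)))) <->
  (forall s : seq (M * bool), (forall x, x \in s -> letter x) ->
    kappa2 j (unzip1 s) = L2_inj L2 (boundary_cumulant kappa s)).
Proof.
split=> eqs s; last first.
  move=> Ps; rewrite gradient_word // (moment_recursion2 hE hkappa hkappa2).
  apply: (@eq_gap_sum_in _ _ E _ _ letter B) => //; first exact: cexp_in hE.
    exact: tagged_letter_Bl.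
  by move=> t e _ Pt _; rewrite eqs.
have [n] := ubnP (size s); elim: n s => // n IH s; rewrite ltnS => le_s Ps.
have := eqs s Ps; rewrite gradient_word // (moment_recursion2 hE hkappa hkappa2).
move/eqP; rewrite -subr_eq0 (@gap_sum_diff _ _ E _ _ letter B) ?(cexp1 hE) //.
- by rewrite !L2_ract1 subr_eq0 => /eqP.
- exact: cexp_in hE.
- exact: tagged_letter_Bl.
- by move=> t e lt_t Pt _; rewrite IH // (leq_trans lt_t).
Qed.

End GradientWords.

Theorem theorem5p3 (R : realType) (M : vNalgebra R) (tau : {scalar M})
    (htau : faithful_normal_trace tau)
    (L2 : L2_space tau)
    (B : set M) (hB : star_subalgebra B)
    (E : {linear M -> M}) (hE : conditional_expectation B E)
    (htauE : forall x, tau (E x) = tau x)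
    (E2 : L2 -> L2) (hE2 : is_L2_extension E E2)
    (A1 A2 : set M) (hA1 : subalgebra A1) (hA2 : subalgebra A2)
    (hBA1 : B `<=` A1) (hBA2 : B `<=` A2)
    (hfree : algebraically_free_modulo B A1 A2)
    (T : balanced_tensor B (alg_join A1 A2))
    (delta : M -> T) (hdelta : liberation_derivation delta)
    (EE : {linear T -> M}) (hEE : is_tensor_square E EE)
    (kappa : seq M -> M)
    (kappa_part : forall n, {set {set 'I_n}} -> seq M -> M)
    (hkappa : cumulants B E kappa kappa_part)
    (kappa2 : L2 -> seq M -> L2)
    (kappa2_part : forall n, {set {set 'I_n}} -> L2 -> seq M -> L2)
    (hkappa2 : L2_cumulants B E2 kappa kappa2 kappa2_part)
    (j : L2) (hj : L2_generated (A1 `|` A2) j) :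
  (forall a, alg_join A1 A2 a ->
     E2 (L2_ract L2 a j) = L2_inj L2 (EE (delta a)))
  <->
  (kappa2 j [::] = 0 /\
   forall (a : M) (s : seq M),
     (forall x, x \in a :: s -> A1 x \/ A2 x) ->
     kappa2 j (a :: s) = L2_inj L2 (liberation_cumulant kappa A1 A2 a s)).
Proof.
have tag (s : seq M) : (forall x, x \in s -> A1 x \/ A2 x) ->
    exists2 t : seq (M * bool), unzip1 t = s & forall x, x \in t -> tagged_letter A1 A2 x.
  (* Letters in both algebras are tagged as letters of [A1]. *)
  move=> As; exists [seq (x, `[< A1 x >]) | x <- s].
    by rewrite /unzip1 -map_comp map_id.
  move=> _ /mapP[x xs ->]; rewrite /tagged_letter /=.
  by case: asboolP => // nA1x; case: (As x xs).
have untag (t : seq (M * bool)) : (forall x, x \in t -> tagged_letter A1 A2 x) ->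
    forall x, x \in unzip1 t -> A1 x \/ A2 x.
  by move=> Pt _ /mapP[y /Pt/tagged_letterW ? ->].
have words := cumulants_of_words hE hA1 hA2 hBA1 hBA2 hdelta hEE hkappa hkappa2 j.
split=> [grad|[cum0 cum]].
  have {}words := words.1 (fun s Ps => grad _ (tagged_prod Ps)).
  split=> [|a s As].
    (* The empty word yields the equation for the first cumulant of [j]. *)
    by rewrite (words [::]) // /boundary_cumulant /= subrr linear0.
  have [[|x t] //= [<- <-] Pt] := tag _ As.
  by rewrite (liberation_boundary hE hdelta hkappa Pt) -words.
(* The gradient equation is linear in [a], so it suffices to verify it on words. *)
apply: alg_join_ind => [s As|c x y Ax Ay gx gy].
  have [t <- Pt] := tag s As; apply: words.2 => // -[|x r] Pr.
    by rewrite /boundary_cumulant subrr linear0.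
  rewrite /= cum; last exact: untag Pr.
  by rewrite (liberation_boundary hE hdelta hkappa Pr).
rewrite L2_ract_linear (L2_extension_linear hE2) gx gy.
by rewrite (delta_linear hdelta) // !linearP.
Qed.
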